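(* Let $\alpha\in(0,1)$ be irrational, $\beta>1$ and $f(x)=x^{-\beta}$. Let $k(N)$ be a monotone trimming sequence with $k(N)=o(N)$. Then the following are equivalent. (I) The trimmed strong law holds uniformly: there are $d_N>0$ such that $$\lim_{N\to\infty}\frac{S_N^{k(N)}(f)(x)}{d_N}=1\quad\text{uniformly in }x\in[0,1).$$ (II) The trimmed weak law holds: there are $d_N>0$ such that $$\lambda\left(\left|\frac{S_N^{k(N)}(f)}{d_N}-1\right|>\epsilon\right)\to0\ \text{ as }N\to\infty,\qquad\forall\epsilon>0.$$ (III) $$\frac{k(N)}{\max\left(b_n,\max_{j\le n-1}a_j\right)}\to\infty\quad\text{as }N\to\infty.$$ Furthermore, in this situation one can take $d_N=\frac{1}{\beta-1}N^{\beta}k(N)^{1-\beta}$ (for all $N$ large enough that $k(N)\ge1$).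
   Context: $R(x)=x+\alpha\pmod1$ on $[0,1)$ and $\lambda$ is Lebesgue measure on $[0,1)$. A trimming sequence is a sequence of integers $k(N)$, $N\ge 1$, with $0\le k(N)\le N$, and $$S_N^{k}(f)(x)=\sum_{i=0}^{N-1}f(R^ix)-\max_{0\le i_1<\dots<i_k\le N-1}\sum_{j=1}^{k}f(R^{i_j}x)$$ is the sum with the $k$ largest terms removed, with the convention $f(0)=0$. Write $\alpha=[a_1,a_2,\dots]$ (continued fraction expansion), with convergent denominators indexed by $q_0=0$, $q_1=1$, $q_{m+1}=a_mq_m+q_{m-1}$ for $m\ge1$. For each $N\ge1$, $n=n(N)$ denotes the index with $N\in[q_n,q_{n+1}-1]$, and $b_n=b_n(N)=\lfloor N/q_n\rfloor$. *)

(* Defs.v *)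
From mathcomp Require Import all_boot all_order all_algebra.
From mathcomp Require Import all_classical all_reals all_analysis.
Set Implicit Arguments.
Unset Strict Implicit.
Unset Printing Implicit Defensive.
Import Order.TTheory GRing.Theory Num.Theory.
Import numFieldNormedType.Exports.
Local Open Scope classical_set_scope.
Local Open Scope ring_scope.

Definition frac_part (R : realType) (x : R) : R := x - (Num.floor x)%:~R.

Definition rotation (R : realType) (alpha x : R) : R := frac_part (x + alpha).

Definition gauss_map (R : realType) (x : R) : R := frac_part x^-1.

(* [alpha = [a_1, a_2, ...]] with [a_j = cf_digit alpha j] for [1 <= j];
   the value at [j = 0] is junk. *)
Definition cf_digit (R : realType) (alpha : R) (j : nat) : nat :=
  Num.truncn (iter j.-1 (@gauss_map R) alpha)^-1.

(* Shifted indexing: [q_0 = 0], [q_1 = 1], [q_2 = a_1]. *)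
Fixpoint cf_denom (R : realType) (alpha : R) (m : nat) : nat :=
  if m is m1.+1 then
    if m1 is m2.+1
    then (cf_digit alpha m1 * cf_denom alpha m1 + cf_denom alpha m2)%N
    else 1%N
  else 0%N.

(* For irrational [alpha] in (0,1) and [1 <= N] such an index exists and is
   unique, so the default value is not used. *)
Definition cf_index (R : realType) (alpha : R) (N : nat) : nat :=
  xget 0%N [set n | (cf_denom alpha n <= N < cf_denom alpha n.+1)%N].

Definition cf_quot (R : realType) (alpha : R) (N : nat) : nat :=
  (N %/ cf_denom alpha (cf_index alpha N))%N.

(* Index tuples [0 <= i_1 < ... < i_k <= N - 1] are encoded as the [k]-element
   subsets of ['I_N]. For [k <= N] the supremum is over a finite nonempty set,
   i.e. it is a maximum. *)
Definition trimmed_sum (R : realType) (alpha : R) (f : R -> R) (k N : nat)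
    (x : R) : R :=
  \sum_(i < N) f (iter i (rotation alpha) x) -
  sup [set s : R | exists2 A : {set 'I_N}, #|A| = k &
                     s = \sum_(i in A) f (iter i (rotation alpha) x)].

Definition power_obs (R : realType) (beta x : R) : R :=
  if x == 0 then 0 else x `^ (- beta).

Definition trimming_sequence (k : nat -> nat) : Prop :=
  forall N, (0 < N)%N -> (k N <= N)%N.

(* Sequences are indexed by [1 <= N]; the value at [0] is unconstrained. *)
Definition monotone_seq (k : nat -> nat) : Prop :=
  (forall M N, (0 < M)%N -> (M <= N)%N -> (k M <= k N)%N) \/
  (forall M N, (0 < M)%N -> (M <= N)%N -> (k N <= k M)%N).

Definition positive_seq (R : realType) (d : nat -> R) : Prop :=
  forall N, (0 < N)%N -> 0 < d N.

Definition trimmed_strong_law_unif (R : realType) (alpha : R) (f : R -> R)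
    (k : nat -> nat) (d : nat -> R) : Prop :=
  {uniform `[0, 1[%classic,
    (fun (N : nat) (x : R) => trimmed_sum alpha f (k N) N x / d N) @ \oo
      --> (fun=> 1 : R)}.

Definition trimmed_weak_law (R : realType) (alpha : R) (f : R -> R)
    (k : nat -> nat) (d : nat -> R) : Prop :=
  forall eps : R, 0 < eps ->
    lebesgue_measure [set x : R | `[0, 1[%classic x /\
        eps < `|trimmed_sum alpha f (k N) N x / d N - 1|]
      @[N --> \oo] --> 0%E.

Definition trimming_condition (R : realType) (alpha : R) (k : nat -> nat)
    : Prop :=
  (k N)%:R / (maxn (cf_quot alpha N)
                   (\max_(1 <= j < cf_index alpha N) cf_digit alpha j))%:R
    @[N --> \oo] --> (+oo%R : set_system R).

(* Main.v *)
Require Import Defs.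
From mathcomp Require Import all_boot all_order all_algebra.
From mathcomp Require Import all_classical all_reals all_analysis.
From mathcomp Require Import zify ring lra.
Import Order.TTheory GRing.Theory Num.Theory.
Import numFieldNormedType.Exports.
Local Open Scope classical_set_scope.
Local Open Scope ring_scope.
Set Implicit Arguments.
Unset Strict Implicit.
Unset Printing Implicit Defensive.

(** Removing the [k] largest values of [x^-beta] removes the [k] orbit points
closest to [0] on the right, so everything rests on counting the points of an
orbit of length [N] in [[0, t)].

Counting.  If [p/q] is the [n]-th convergent, [alpha] differs from [p/q] by less
than [1/q^2], so [q] consecutive orbit points shadow the grid of step [1/q] and
their number in [[0, t)] is [t q] up to [4] ([visits_denom]).  Cutting [0..N-1]
greedily into blocks whose lengths are convergent denominators costs [4] per
block; the number of blocks of one length is at most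
[M = max(b_n, max_(j < n) a_j)].  Only a fixed number of levels has to be cut
this way: denominators grow geometrically, so what is left afterwards is a small
proportion of [N] ([visits_error]).  Hence if [k / M] tends to infinity, the
count is [t N + o(k + t N)] uniformly in [x] and [t] ([visits_uniform]).

Sufficiency.  Then the orbit point with [r] predecessors is [(1 + o(1)) r / N] for
all [r >= k] ([orbit_rank_bounds]), the trimmed sum is
[(1 + o(1)) N^beta \sum_(r >= k) r^-beta], and the sum telescopes up to constants
to [k^(1 - beta) / (beta - 1)] ([trimmed_sum_upper], [trimmed_sum_lower]).

Necessity.  If [k / M] does not tend to infinity, the monotonicity of [k] gives
arbitrarily long times [N = b q_n] with [b] at most about [a_n / 12] and
[k(N) <= C b] ([undertrimmed_scales]).  At such a time the orbit consists of [q_n]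
short clusters of [b] points.  For at least half of the [x] no cluster meets
[[1 - Delta, 1)], where [Delta = 1 / (12 q_n)]; rotating such an [x] by [Delta]
moves every orbit point to the right by exactly [Delta].  At most [C] clusters
are trimmed, so the first surviving cluster carries a fixed proportion of the
trimmed sum, and the shift lowers the trimmed sum by a factor [1 - eta] with [eta]
depending only on [C] and [beta] ([trimmed_sum_shift]).  A weak law forces the
trimmed sums at [x] and at [x + Delta] to be both close to [d_N] for most [x],
which is impossible. *)

(** * Orbits of the rotation *)

Lemma frac_part_itv (R : realType) (x : R) : 0 <= frac_part x < 1.
Proof.
by rewrite /frac_part; have := floor_itv x; rewrite intrD => /andP[? ?]; lra.
Qed.

Lemma frac_part_eq (R : realType) (x y : R) (z : int) :
  0 <= y < 1 -> x = y + z%:~R -> frac_part x = y.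
Proof.
move=> /andP[y0 y1] ->; rewrite /frac_part (@floor_def _ _ z); first by lra.
by rewrite intrD; apply/andP; split; lra.
Qed.

Lemma frac_part_id (R : realType) (x : R) : 0 <= x < 1 -> frac_part x = x.
Proof. by move=> x01; apply: (@frac_part_eq _ _ _ 0) => //; rewrite addr0. Qed.

Lemma iter_rotationE (R : realType) (alpha x : R) i : 0 <= x < 1 ->
  iter i (rotation alpha) x = frac_part (x + i%:R * alpha).
Proof.
move=> x01; elim: i => [|i IH]; first by rewrite mul0r addr0 frac_part_id.
rewrite iterS IH /rotation.
apply: (frac_part_eq (z := Num.floor (x + i.+1%:R * alpha) - Num.floor (x + i%:R * alpha))).
  exact: frac_part_itv.
by rewrite /frac_part intrB -natr1; ring.
Qed.

Lemma iter_rotation_itv (R : realType) (alpha x : R) i : 0 <= x < 1 ->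
  0 <= iter i (rotation alpha) x < 1.
Proof. by move=> x01; rewrite iter_rotationE// frac_part_itv. Qed.

Lemma irrational_multiple (R : realType) (alpha : R) (n z : int) :
  irrational alpha -> n != 0 -> n%:~R * alpha != z%:~R.
Proof.
move=> irr n0; apply/eqP => nz; apply: irr; exists (z%:~R / n%:~R) => //.
by rewrite fmorph_div/= !ratr_int -nz mulrAC mulfV ?mul1r// intr_eq0.
Qed.

Lemma iter_rotation_inj (R : realType) (alpha x : R) i j :
  irrational alpha -> 0 <= x < 1 ->
  iter i (rotation alpha) x = iter j (rotation alpha) x -> i = j.
Proof.
move=> irr x01; rewrite !iter_rotationE// /frac_part => /eqP.
set u := Num.floor _; set v := Num.floor _ => E.
have {}E : (i%:Z - j%:Z)%:~R * alpha = (u - v)%:~R.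
  by rewrite !intrB -!pmulrn; move/eqP: E; lra.
apply/eqP; rewrite -eqz_nat -subr_eq0; apply: contraT => /irrational_multiple.
by move=> /(_ _ alpha (u - v) irr); rewrite E eqxx.
Qed.

(** * Continued fractions and convergents *)

Section ContinuedFraction.
Variables (R : realType) (alpha : R).
Hypotheses (alpha01 : 0 < alpha < 1) (irr : irrational alpha).

Let g j := iter j (@gauss_map R) alpha.
Let q := cf_denom alpha.

Lemma gauss_iter_irrational j : irrational (g j).
Proof.
elim: j => //= j IH [r _ rE]; apply: IH.
exists (r + (Num.floor (g j)^-1)%:~R)^-1 => //.
by rewrite fmorphV/= rmorphD/= ratr_int rE /gauss_map /frac_part subrK invrK.
Qed.

Lemma gauss_iter_itv j : 0 < g j < 1.
Proof.
have neq0 i : g i != 0.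
  have := @irrational_multiple _ _ 1 0 (@gauss_iter_irrational i).
  by rewrite mul1r; apply.
case: j => // j; have /andP[h0 h1] := frac_part_itv (g j)^-1.
by rewrite h1 andbT lt_neqAle h0 andbT eq_sym (neq0 j.+1).
Qed.

Lemma gauss_iter_inv j : (g j)^-1 = (cf_digit alpha j.+1)%:R + g j.+1.
Proof.
have /andP[g0 _] := gauss_iter_itv j.
rewrite /cf_digit /= /gauss_map /frac_part truncn_floor -/(g j).
have gV : 0 <= (g j)^-1 by rewrite invr_ge0 ltW.
rewrite gV [X in X + _]pmulrn gez0_abs ?floor_ge0//; ring.
Qed.

Lemma cf_digit_gt0 j : (0 < j)%N -> (0 < cf_digit alpha j)%N.
Proof.
case: j => // j _; have := gauss_iter_inv j; have /andP[g0 g1] := gauss_iter_itv j.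
have /andP[h0 h1] := gauss_iter_itv j.+1.
case: cf_digit => //; rewrite add0r => E.
have : 1 < (g j)^-1 by rewrite invf_gt1.
by rewrite E; lra.
Qed.

Lemma cf_denomSS m : q m.+2 = (cf_digit alpha m.+1 * q m.+1 + q m)%N.
Proof. by []. Qed.

Lemma cf_denom_le m n : (m <= n)%N -> (q m <= q n)%N.
Proof.
move: m n; apply: (@homo_leq _ q leq) => // [y x z|]; first exact: leq_trans.
case=> // m; rewrite cf_denomSS.
by have := cf_digit_gt0 (ltn0Sn m); nia.
Qed.

Lemma cf_denom_gt0 n : (0 < n)%N -> (0 < q n)%N.
Proof. by move=> n0; apply: leq_trans (cf_denom_le n0). Qed.

(** Two steps of the recursion at least double the denominator, whatever the
digits are. *)
Lemma cf_denom_double n s : (2 ^ s * q (n - s.*2) <= q n)%N.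
Proof.
elim: s n => [|s IH] n; first by rewrite mul1n subn0.
case: n => [|[|n]].
- by rewrite sub0n muln0.
- by rewrite doubleS (_ : (1 - _)%N = 0%N) ?muln0//; lia.
rewrite doubleS subSS subSS expnS.
have := IH n; have := cf_denom_le (leqnSn n); rewrite cf_denomSS.
by have := cf_digit_gt0 (ltn0Sn n); nia.
Qed.

Lemma cf_denom_ge n : (0 < n)%N -> (2 ^ (n.-1)./2 <= q n)%N.
Proof.
move=> n0; apply: leq_trans (cf_denom_double n n.-1./2).
rewrite leq_pmulr// cf_denom_gt0//; lia.
Qed.

(** The numerators of the convergents, with the same shift of indices as
[cf_denom]: the list starts with those of [1/0] and [0/1]. *)
Fixpoint cf_numer m : nat :=
  if m is m1.+1 then
    if m1 is m2.+1
    then (cf_digit alpha m1 * cf_numer m1 + cf_numer m2)%N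
    else 0%N
  else 1%N.

(** The distance of [q_n alpha] to the nearest integer [p_n], see [cf_gapE]; the
product formula makes its positivity evident. *)
Definition cf_gap n : R := \prod_(j < n) g j.

Lemma cf_gap_gt0 n : 0 < cf_gap n.
Proof. by apply: prodr_gt0 => j _; case/andP: (gauss_iter_itv j). Qed.

Lemma cf_gapSS n :
  cf_gap n = (cf_digit alpha n.+1)%:R * cf_gap n.+1 + cf_gap n.+2.
Proof.
rewrite /cf_gap !big_ord_recr/=; set P := \prod_(_ < _) _.
have /andP[g0 _] := gauss_iter_itv n.
have := gauss_iter_inv n; rewrite -/(g n) -/(g n.+1) => E.
transitivity (P * g n * (g n)^-1); first by rewrite mulfK// gt_eqF.
by rewrite E /=; set h := gauss_map _; ring.
Qed.

Lemma cf_gapE n :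
  (q n)%:R * alpha - (cf_numer n)%:R = (-1) ^+ n.+1 * cf_gap n.
Proof.
suff : (q n)%:R * alpha - (cf_numer n)%:R = (-1) ^+ n.+1 * cf_gap n /\
  (q n.+1)%:R * alpha - (cf_numer n.+1)%:R = (-1) ^+ n.+2 * cf_gap n.+1 by case.
elim: n => [|n [IH1 IH2]].
  rewrite /cf_gap big_ord0 big_ord1 /g/=.
  by split; rewrite ?expr1 ?expr2 /q/=; ring.
split=> //; rewrite cf_denomSS [cf_numer _.+2]/= -/(cf_numer n.+1) !natrD !natrM.
have := cf_gapSS n; move: IH1 IH2; rewrite !exprS.
set e := (-1) ^+ n; set a := (cf_digit _ _)%:R => IH1 IH2 gE.
transitivity (a * ((q n.+1)%:R * alpha - (cf_numer n.+1)%:R) +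
  ((q n)%:R * alpha - (cf_numer n)%:R)); first by ring.
by rewrite IH1 IH2 gE; ring.
Qed.

(** The recursions of [q] and of the gaps carry opposite signs, so this
combination does not change from one step to the next; it bounds the gaps. *)
Lemma cf_gap_bezout n :
  (q n.+1)%:R * cf_gap n + (q n)%:R * cf_gap n.+1 = 1.
Proof.
elim: n => [|n IH]; first by rewrite /cf_gap big_ord0 mul1r mul0r addr0.
by rewrite cf_denomSS natrD natrM -[RHS]IH (cf_gapSS n); ring.
Qed.

Lemma cf_gap_le n : (q n.+1)%:R * cf_gap n <= 1.
Proof.
rewrite -[leRHS](cf_gap_bezout n) lerDl mulr_ge0// ltW//; exact: cf_gap_gt0.
Qed.

(** The determinant of consecutive convergents is [(-1)^n]; the sign is written
with [odd] on both sides to stay in [nat]. *)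
Lemma cf_det n :
  (cf_numer n * q n.+1 + odd n = cf_numer n.+1 * q n + ~~ odd n)%N.
Proof.
elim: n => [//|n]; rewrite cf_denomSS [cf_numer n.+2]/= -/(cf_numer n.+1) /=.
rewrite !mulnDl !mulnDr; set a := cf_digit _ _.
move: (cf_numer n) (cf_numer n.+1) (q n) (q n.+1) => p p' r r'.
by case: (odd n) => /= E; nia.
Qed.

Lemma cf_coprime n : coprime (cf_numer n) (q n).
Proof.
rewrite /coprime -dvdn1; set d := gcdn _ _.
have d1 : (d %| cf_numer n * q n.+1)%N by rewrite dvdn_mulr ?dvdn_gcdl.
have d2 : (d %| cf_numer n.+1 * q n)%N by rewrite dvdn_mull ?dvdn_gcdr.
have := cf_det n; case: (odd n) => /= E.
  by rewrite -(dvdn_addr _ d1) E addn0.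
by rewrite -(dvdn_addr _ d2) -E addn0.
Qed.

End ContinuedFraction.

(** * Counting visits of an orbit to an initial interval *)

Definition visits (R : realType) (alpha : R) (N : nat) (x t : R) : nat :=
  \sum_(i < N) (iter i (rotation alpha) x < t)%R.

Lemma visits_add (R : realType) (alpha : R) M N (x t : R) :
  visits alpha (M + N) x t =
  (visits alpha M x t + visits alpha N (iter M (rotation alpha) x) t)%N.
Proof.
rewrite /visits big_split_ord/=; congr (_ + _)%N.
by apply: eq_bigr => i _; rewrite -iterD addnC.
Qed.

Lemma visits_le (R : realType) (alpha : R) M N (x t : R) : (M <= N)%N ->
  (visits alpha M x t <= visits alpha N x t)%N.
Proof. by move=> /subnKC <-; rewrite visits_add leq_addr. Qed.

Lemma sum_ord_lt_le (R : realType) (c : R) (n : nat) : 0 <= c ->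
  (\sum_(j < n) (j%:R < c)%R)%:R <= c + 1.
Proof.
move=> c0; elim: n => [|n IH]; first by rewrite big_ord0; lra.
rewrite big_ord_recr /= natrD; case: ltP => /= nc; last by rewrite addr0.
have : (\sum_(j < n) (j%:R < c)%R <= n)%N.
  by rewrite -[leqRHS]card_ord -sum1_card leq_sum// => i _; case: ltP.
rewrite -(ler_nat R); lra.
Qed.

Lemma sum_ord_le_ge (R : realType) (c : R) (n : nat) : c <= n%:R ->
  c <= (\sum_(j < n) (j%:R <= c)%R)%:R.
Proof.
suff : c <= (\sum_(j < n) (j%:R <= c)%R)%:R \/
    n%:R <= ((\sum_(j < n) (j%:R <= c)%R)%:R : R) by move=> []//; lra.
elim: n => [|n IH]; first by right; rewrite big_ord0.
rewrite big_ord_recr /= natrD; case: (leP n%:R c) => /= nc.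
  by right; rewrite -natr1; case: IH => ?; lra.
by left; case: IH => ?; lra.
Qed.

(** ** The Denjoy-Koksma bound and block decompositions *)

Section DenjoyKoksma.
Variables (R : realType) (alpha : R).
Hypotheses (alpha01 : 0 < alpha < 1) (irr : irrational alpha).
Let q := cf_denom alpha.
Let p := cf_numer alpha.

(** The cell of the grid of step [1/q_n] in which the [i]-th orbit point would be
if [alpha] were equal to [p_n/q_n] and [x] were rounded down to the grid. *)
Definition orbit_slot n (x : R) (i : nat) : nat :=
  ((Num.truncn ((q n)%:R * x) + i * p n) %% q n)%N.

Lemma orbit_slot_inj n x i j : (i < q n)%N -> (j < q n)%N ->
  orbit_slot n x i = orbit_slot n x j -> i = j.
Proof.
move=> iq jq; wlog ij : i j iq jq / (i <= j)%N.
  by move=> W E; case/orP: (leq_total i j) => ij; [|symmetry]; apply: W.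
move=> /eqP; rewrite /orbit_slot eqn_modDl eq_sym eqn_mod_dvd; last first.
  by rewrite leq_mul2r ij orbT.
rewrite -mulnBl Gauss_dvdl; last by rewrite coprime_sym cf_coprime.
case: (posnP (j - i)) => [|h0 /(dvdn_leq h0)]; lia.
Qed.

(** The drift [i |alpha - p_n/q_n|] stays below [1/q_n] for [i < q_n], so a point
is at most one cell away from its slot.  The first and the last slot are left
out: there the drift may carry the point across [0]. *)
Lemma orbit_slot_near n (x : R) i : (0 < n)%N -> 0 <= x < 1 -> (i < q n)%N ->
  let j := orbit_slot n x i in (0 < j)%N -> (j.+1 < q n)%N ->
  j%:R - 1 < (q n)%:R * iter i (rotation alpha) x < j%:R + 2.
Proof.
move=> n0 x01 iq j j0 jq; set Q : R := (q n)%:R.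
have Q0 : 0 < Q by rewrite ltr0n cf_denom_gt0.
have Qi : i%:R + 1 <= Q by rewrite natr1 ler_nat.
have Qj : j%:R + 2 <= Q by rewrite -natrD ler_nat addn2.
have j1 : 1 <= j%:R :> R by rewrite ler1n.
set th := alpha - (p n)%:R / Q.
have QthE : Q * th = (-1) ^+ n.+1 * cf_gap alpha n.
  by rewrite -cf_gapE// /th mulrBr mulrCA mulfV ?gt_eqF// mulr1.
(* this is where [q_n gap_n <= q_(n+1) gap_n <= 1] enters *)
have thle : `|Q * th| * Q <= 1.
  rewrite QthE normrM normrX normrN1 expr1n mul1r gtr0_norm ?cf_gap_gt0//.
  apply: le_trans (cf_gap_le alpha01 irr n); rewrite mulrC ler_wpM2r ?ler_nat ?cf_denom_le//.
  by rewrite ltW// cf_gap_gt0.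
have ith : `|i%:R * (Q * th)| < 1.
  rewrite normrM ger0_norm//; have := normr_ge0 (Q * th).
  rewrite le_eqVlt => /predU1P[<-|]; first by rewrite mulr0.
  nra.
have [x0 x1] := andP x01.
set m := Num.truncn (Q * x).
have mE : m%:R <= Q * x < m%:R + 1 by rewrite natr1 truncn_itv// mulr_ge0// ltW.
have jE : m%:R + i%:R * (p n)%:R = ((m + i * p n) %/ q n)%:R * Q + j%:R.
  by rewrite -!natrM -!natrD -divn_eq.
set k := (_ %/ _)%N in jE.
have zE : Q * (x + i%:R * alpha) = Q * x - m%:R + i%:R * (Q * th) + j%:R + k%:R * Q.
  have -> : alpha = th + (p n)%:R / Q by rewrite /th subrK.
  transitivity (Q * x + i%:R * (Q * th) + i%:R * (p n)%:R * (Q / Q)); first by ring.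
  by rewrite divff ?gt_eqF// mulr1; lra.
set z := (Q * x - m%:R + i%:R * (Q * th) + j%:R) / Q.
have zQ : Q * z = Q * x - m%:R + i%:R * (Q * th) + j%:R.
  by rewrite /z mulrC divfK// gt_eqF.
have zb : j%:R - 1 < Q * z < j%:R + 2.
  by rewrite zQ; move: ith; rewrite ltr_norml; lra.
have z01 : 0 <= z < 1.
  rewrite -(pmulr_rge0 _ Q0) -(ltr_pM2l Q0) mulr1; lra.
rewrite iter_rotationE// (@frac_part_eq _ _ z k)// -pmulrn.
apply: (mulfI (lt0r_neq0 Q0)); rewrite zE [RHS]mulrDr zQ; ring.
Qed.

(** [p_n] is invertible modulo [q_n], so every slot is used exactly once. *)
Lemma sum_orbit_slot n (x : R) (F : nat -> nat) :
  (\sum_(i < q n) F (orbit_slot n x i) = \sum_(j < q n) F j)%N.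
Proof.
have lt i : (i < q n)%N -> (orbit_slot n x i < q n)%N.
  by move=> iq; rewrite ltn_mod; apply: leq_ltn_trans iq.
pose s (i : 'I_(q n)) := Ordinal (lt i (ltn_ord i)).
have sinj : injective s.
  move=> i j /(congr1 val)/= /orbit_slot_inj E; apply: val_inj; exact: E.
by rewrite [RHS](reindex_inj sinj).
Qed.

Lemma sum_ord_pred1 n a : (\sum_(j < n) (j == a :> nat) <= 1)%N.
Proof.
have [an|an] := ltnP a n.
  rewrite (bigD1 (Ordinal an))//= eqxx big1// => i /eqP ia.
  by case: eqP => // E; case: ia; apply: val_inj.
by rewrite big1// => i _; case: eqP => // E; have := ltn_ord i; lia.
Qed.

(** Points and slots are matched one to one up to one cell on either side, which
accounts for an error of [2]; the two exceptional slots account for the rest. *)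
Lemma visits_denom n (x t : R) : (0 < n)%N -> 0 <= x < 1 -> 0 <= t <= 1 ->
  `|(visits alpha (q n) x t)%:R - t * (q n)%:R| <= 4.
Proof.
move=> n0 x01 /andP[t0 t1]; set Q : R := (q n)%:R.
have Q0 : 0 < Q by rewrite ltr0n cf_denom_gt0.
(* the exceptional slots, where nothing is known about the point *)
pose E j := ((j == 0%N) + (j == (q n).-1))%N.
have sumE : (\sum_(j < q n) E j <= 2)%N.
  by rewrite big_split /= (leq_add (sum_ord_pred1 _ _) (sum_ord_pred1 _ _)).
have near i : (i < q n)%N -> (0 < E (orbit_slot n x i))%N \/
    (orbit_slot n x i)%:R - 1 < Q * iter i (rotation alpha) x
      < (orbit_slot n x i)%:R + 2.
  move=> iq; have := orbit_slot_near n0 x01 iq.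
  have : (orbit_slot n x i < q n)%N by rewrite ltn_mod; apply: leq_ltn_trans iq.
  rewrite /E; move: (orbit_slot n x i) => j jq /= H.
  case: (j =P 0%N) => [|j0]; first by left.
  case: (j =P (q n).-1) => [|jq1]; first by left.
  by right; apply: H; lia.
have up : (visits alpha (q n) x t <=
    \sum_(j < q n) (j%:R < t * Q + 1)%R + \sum_(j < q n) E j)%N.
  rewrite -big_split/= -(sum_orbit_slot n x (fun j => (j%:R < t * Q + 1)%R + E j)%N).
  apply: leq_sum => i _; case: (near i (ltn_ord i)) => [?|].
    by case: (_ < t); lia.
  move=> /andP[h _]; case: (ltP _ t) => [it|]; last by rewrite leq0n.
  by rewrite (_ : _ < _)//; move: it; rewrite -(ltr_pM2l Q0); lra.
have dn : (\sum_(j < q n) (j%:R <= t * Q - 2)%R <=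
    visits alpha (q n) x t + \sum_(j < q n) E j)%N.
  rewrite -(sum_orbit_slot n x E) -(sum_orbit_slot n x (fun j => (j%:R <= t * Q - 2)%R : nat)).
  rewrite /visits -big_split/=.
  apply: leq_sum => i _; case: (near i (ltn_ord i)) => [?|].
    by case: (_ <= t * Q - 2); lia.
  move=> /andP[_ h]; case: (leP _ (t * Q - 2)) => [it|]; last by rewrite leq0n.
  by rewrite (_ : _ < t)//; rewrite -(ltr_pM2l Q0); lra.
have tQ0 : 0 <= t * Q + 1 by rewrite addr_ge0// mulr_ge0// ltW.
have tQ1 : t * Q - 2 <= (q n)%:R by rewrite -/Q; nra.
have := sum_ord_lt_le (q n) tQ0; have := sum_ord_le_ge tQ1.
move: up dn sumE; rewrite -3!(ler_nat R) !natrD ler_norml; lra.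
Qed.

Lemma visits_denom_multiple n b (x t : R) : (0 < n)%N -> 0 <= x < 1 -> 0 <= t <= 1 ->
  `|(visits alpha (b * q n) x t)%:R - t * (b * q n)%:R| <= 4 * b%:R.
Proof.
move=> n0 x01 t01; elim: b x x01 => [|b IH] x x01.
  by rewrite !mul0n /visits big_ord0 !mulr0 subrr normr0.
rewrite mulSn visits_add.
have /(IH _) := iter_rotation_itv alpha (q n) x01.
have := visits_denom n0 x01 t01; rewrite !natrD -(natr1 b) !ler_norml; lra.
Qed.

(** [l] is the number of levels of the greedy decomposition of [N] that are used.
Each level contributes at most [M] blocks, hence an error [4 M]; the remainder is
shorter than one block of length [q (n + 1 - l)], and both its count and its
expected count are bounded by the count of that whole block.  A bound with the
maximum of the digits, instead of their sum, is possible because [l] is kept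
free.  The bound on the number of blocks is waived for [n = 0], where [q_0 = 0]
and [N < q_1] forces [N = 0]; the induction may reach that level. *)
Lemma visits_error l n N M (x t : R) : (N < q n.+1)%N -> (N < M.+1 * q n)%N || (n == 0%N) ->
  (forall j, (0 < j < n)%N -> (cf_digit alpha j <= M)%N) ->
  0 <= x < 1 -> 0 <= t <= 1 ->
  `|(visits alpha N x t)%:R - t * N%:R| <=
    (4 * M * l)%:R + t * (q (n.+1 - l))%:R + 4.
Proof.
move=> Nq NM aM x01 /andP[t0 t1].
elim: l n N Nq NM aM x x01 => [|l IH] n N Nq NM aM x x01.
  rewrite muln0 subn0 add0r; have tq0 : 0 <= t * (q n.+1)%:R by rewrite mulr_ge0.
  have := visits_denom (ltn0Sn n) x01 (introT andP (conj t0 t1)).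
  have := visits_le alpha x t (ltnW Nq); rewrite -(ler_nat R).
  have : 0 <= (visits alpha N x t)%:R :> R by [].
  have : t * N%:R <= t * (q n.+1)%:R by rewrite ler_wpM2l// ler_nat ltnW.
  have : 0 <= t * N%:R by rewrite mulr_ge0.
  rewrite !ler_norml; lra.
case: n => [|n] in Nq NM aM *.
  have -> : N = 0%N by move: Nq; rewrite /q/=; lia.
  rewrite /visits big_ord0 !mulr0 subrr normr0.
  have : 0 <= t * (q (1 - l.+1))%:R by rewrite mulr_ge0.
  have : 0 <= (4 * M * l.+1)%:R :> R by [].
  lra.
have qn0 := cf_denom_gt0 alpha01 irr (ltn0Sn n).
set b := (N %/ q n.+1)%N; set r := (N %% q n.+1)%N.
have NE : N = (b * q n.+1 + r)%N by rewrite {1}(divn_eq N (q n.+1)).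
have rq : (r < q n.+1)%N by rewrite ltn_mod.
have bM : (b <= M)%N by rewrite -ltnS ltn_divLR//; move: NM; rewrite orbF.
rewrite subSS {1 2}NE visits_add.
have := visits_denom_multiple b (ltn0Sn n) x01 (introT andP (conj t0 t1)).
have y01 := iter_rotation_itv alpha (b * q n.+1) x01.
have := IH n r rq _ _ _ y01.
have -> : (r < M.+1 * q n)%N || (n == 0%N).
  move: (r) rq aM; clear -alpha01 irr.
  case: n => [|n] r rq aM; first by rewrite orbT.
  have := aM n.+1; rewrite !ltnSn/= => /(_ isT).
  have := cf_denom_le alpha01 irr (leqnSn n); rewrite -/q => qq aM'.
  move: rq; rewrite /q cf_denomSS// -/q orbF => rq'.
  by apply: leq_trans rq' _; nia.
move=> /(_ isT) H.
have aM' j : (0 < j < n)%N -> (cf_digit alpha j <= M)%N.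
  by move=> /andP[j0 jn]; rewrite aM// j0 ltnW.
move: {H}(H aM').
have : b%:R <= M%:R :> R by rewrite ler_nat.
rewrite !natrD mulnS natrD (natrM _ 4 M) (natrM _ (4 * M)) !ler_norml mulrDr; lra.
Qed.

End DenjoyKoksma.

(** * Trimmed sums and ranks *)

Lemma sum_setC_split (R : realType) (N : nat) (v : 'I_N -> R) (A : {set 'I_N}) :
  \sum_i v i = \sum_(i in A) v i + \sum_(i in ~: A) v i.
Proof.
rewrite (bigID (mem A))/=; congr (_ + _).
by apply: eq_bigl => i; rewrite finset.in_setC.
Qed.

Lemma trimmed_sum_max (R : realType) (alpha : R) (f : R -> R) k N x :
  (k <= N)%N ->
  exists2 A : {set 'I_N}, #|A| = k &
    trimmed_sum alpha f k N x = \sum_(i in ~: A) f (iter i (rotation alpha) x) /\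
    forall B : {set 'I_N}, #|B| = k ->
      \sum_(i in B) f (iter i (rotation alpha) x) <=
      \sum_(i in A) f (iter i (rotation alpha) x).
Proof.
move=> kN; pose v (i : 'I_N) := f (iter i (rotation alpha) x).
pose A1 : {set 'I_N} := [set widen_ord kN i | i in 'I_k]%SET.
have A1k : #|A1| == k.
  by rewrite card_imset ?card_ord// => i j /(congr1 val) ij; apply: val_inj.
have [A /eqP Ak Amax] := @arg_maxP _ _ _ A1 (fun A => #|A| == k) (fun A => \sum_(i in A) v i) A1k.
have Amax' (B : {set 'I_N}) : #|B| = k -> \sum_(i in B) v i <= \sum_(i in A) v i.
  by move=> Bk; apply: Amax; apply/eqP.
exists A => //; split => //.
rewrite /trimmed_sum; set S := [set _ | _].
have ubS : ubound S (\sum_(i in A) v i).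
  by move=> _ [B Bk ->]; apply: Amax'.
have SA : S (\sum_(i in A) v i) by exists A.
have -> : sup S = \sum_(i in A) v i.
  apply/eqP; rewrite eq_le ge_sup//=; last by exists (\sum_(i in A) v i).
  by apply: ub_le_sup => //; exists (\sum_(i in A) v i).
by rewrite (sum_setC_split _ A) addrAC subrr add0r.
Qed.

Lemma trimmed_sum_le (R : realType) (alpha : R) (f : R -> R) N (A : {set 'I_N}) x :
  trimmed_sum alpha f #|A| N x <= \sum_(i in ~: A) f (iter i (rotation alpha) x).
Proof.
have AN : (#|A| <= N)%N by rewrite -[leqRHS]card_ord max_card.
have [B BA [-> Bmax]] := trimmed_sum_max alpha f x AN.
have := Bmax A erefl.
have := sum_setC_split (fun i : 'I_N => f (iter i (rotation alpha) x)) A.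
by rewrite (sum_setC_split _ B); lra.
Qed.

(** [B :\: A] and [A :\: B] have the same size, and every value on the former is
at most the smallest value on the latter. *)
Lemma sum_le_top (R : realType) (N : nat) (v : 'I_N -> R) (A B : {set 'I_N}) :
  #|B| = #|A| -> (forall i j, i \in A -> j \notin A -> v j <= v i) ->
  \sum_(i in B) v i <= \sum_(i in A) v i.
Proof.
move=> BA top.
have card_eq : #|B :\: A| = #|A :\: B|.
  by have := cardsID A B; have := cardsID B A; rewrite finset.setIC BA; lia.
rewrite (big_setID A)/= [leRHS](big_setID B)/= finset.setIC lerD2l.
have [AB0|[i0 i0AB]] := finset.set_0Vmem (A :\: B).
  move: card_eq; rewrite AB0 cards0 => /eqP; rewrite cards_eq0 => /eqP ->.
  by rewrite !big_set0.
have [i iAB imin] := @arg_minP _ _ _ i0 (fun i => i \in A :\: B) v i0AB.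
have iA : i \in A by move: iAB; rewrite finset.in_setD => /andP[].
apply: (@le_trans _ _ (\sum_(j in B :\: A) v i)).
  apply: ler_sum => j; rewrite finset.in_setD => /andP[jA _]; exact: top.
rewrite sumr_const card_eq -sumr_const; exact: ler_sum.
Qed.

Section Rank.
Variables (R : realType) (N : nat) (v : 'I_N -> R).
Hypothesis v_inj : injective v.

(** The position of [v i] in the decreasing rearrangement of the values, counted
from [0]. *)
Definition rank (i : 'I_N) : nat := #|[set j | v i < v j]%SET|.

Lemma ltn_rank i : (rank i < N)%N.
Proof.
rewrite -[ltnRHS]card_ord -cardsT; apply: proper_card.
rewrite finset.properT; apply/eqP => /setP/(_ i); by rewrite !finset.in_set ltxx.
Qed.

Lemma rank_lt i j : v i < v j -> (rank j < rank i)%N.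
Proof.
move=> ij; apply: proper_card; apply/properP; split.
  by apply/fintype.subsetP => l; rewrite !finset.in_set; apply: lt_trans.
by exists j; rewrite !finset.in_set ?ltxx.
Qed.

Lemma rank_inj : injective rank.
Proof.
move=> i j ij; apply: v_inj; case: (ltgtP (v i) (v j)) => // /rank_lt.
  by rewrite ij ltnn.
by rewrite ij ltnn.
Qed.

(** The values being distinct, [rank] is a permutation of the indices. *)
Lemma sum_rank (F : nat -> R) m n : (n <= N)%N ->
  \sum_(i < N | (m <= rank i < n)%N) F (rank i) = \sum_(m <= j < n) F j.
Proof.
move=> nN; pose s i := Ordinal (ltn_rank i).
have s_inj : injective s by move=> i j /(congr1 val)/rank_inj.
rewrite (big_nat_widenl _ 0%N)// (big_nat_widen _ _ _ _ _ nN) big_mkord.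
by rewrite [RHS](reindex_inj s_inj).
Qed.

Lemma card_rank_lt k : (k <= N)%N -> #|[set i | (rank i < k)%N]%SET| = k.
Proof.
move=> kN; pose s i := Ordinal (ltn_rank i).
have s_inj : injective s by move=> i j /(congr1 val)/rank_inj.
rewrite -sum1_card (eq_bigl (fun i => s i < k)%N); last by move=> i; rewrite finset.in_set.
rewrite -(reindex_inj (P := fun j : 'I_N => (j < k)%N) (F := fun=> 1%N) s_inj)/=.
by rewrite -(big_ord_widen _ (fun=> 1%N) kN) sum_nat_const card_ord muln1.
Qed.

End Rank.

Lemma trimmed_sum_rank (R : realType) (alpha : R) (f : R -> R) k N x
    (v := fun i : 'I_N => f (iter i (rotation alpha) x)) :
  (k <= N)%N -> injective v ->
  trimmed_sum alpha f k N x = \sum_(i < N | (k <= rank v i)%N) v i.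
Proof.
move=> kN v_inj; set A := [set i | (rank v i < k)%N]%SET.
have Ak : #|A| = k := card_rank_lt v_inj kN.
have AE : \sum_(i in ~: A) v i = \sum_(i < N | (k <= rank v i)%N) v i.
  by apply: eq_bigl => i; rewrite finset.in_setC finset.in_set -leqNgt.
apply/eqP; rewrite eq_le -{1}AE -{1}Ak trimmed_sum_le/=.
have [B Bk [-> _]] := trimmed_sum_max alpha f x kN; rewrite -AE.
have : \sum_(i in B) v i <= \sum_(i in A) v i.
  apply: sum_le_top; first by rewrite Bk Ak.
  move=> i j; rewrite !finset.in_set -leqNgt => ik kj; rewrite leNgt; apply/negP => /rank_lt.
  by move=> /leq_trans-/(_ _ (ltnW ik)); lia.
by have := sum_setC_split v A; rewrite (sum_setC_split v B) /v; lra.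
Qed.

(** * Sums of powers *)

(** Both [expR] and [ln] stay on one side of their tangent lines. *)
Lemma powR_bernoulli (R : realType) (p x : R) : p <= 0 -> 0 < x ->
  1 + p * (x - 1) <= x `^ p.
Proof.
move=> p0 x0; rewrite /powR gt_eqF//; apply: le_trans (expR_ge1Dx _).
have : ln x <= x - 1 by rewrite -{1}(subrKC 1 x) le_ln1Dx//; lra.
by rewrite lerD2l => lnx; rewrite ler_wnM2l.
Qed.

Section PowerSum.
Variables (R : realType) (beta : R).
Hypothesis beta1 : 1 < beta.

(** Bernoulli at [(a + 1) / a] and at [a / (a + 1)]: the function [r^-beta] is
compared with a telescoping difference. *)
Lemma powR_step (a : R) : 0 < a ->
  (beta - 1) * (a + 1) `^ (- beta) <= a `^ (1 - beta) - (a + 1) `^ (1 - beta)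
    <= (beta - 1) * a `^ (- beta).
Proof.
move=> a0.
have a10 : 0 < a + 1 by lra.
have pE (b : R) : 0 < b -> b `^ (1 - beta) = b * b `^ (- beta).
  by move=> b0; rewrite powRD ?powRr1 ?ltW// (gt_eqF b0) implybT.
have key (b c : R) : 0 < b -> 0 < c ->
    b `^ (1 - beta) + (1 - beta) * (c - b) * b `^ (- beta) <= c `^ (1 - beta).
  move=> b0 c0; have p0 : 1 - beta <= 0 by rewrite subr_le0 ltW.
  have := powR_bernoulli p0 (divr_gt0 c0 b0).
  have bp : 0 < b `^ (1 - beta) by rewrite powR_gt0.
  rewrite -(ler_pM2r bp).
  have <- : c `^ (1 - beta) = (c / b) `^ (1 - beta) * b `^ (1 - beta).
    by rewrite -powRM ?ltW ?divr_gt0// divfK ?gt_eqF.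
  apply: le_trans; rewrite (pE _ b0); set B := b `^ (- beta).
  by rewrite le_eqVlt; apply/orP; left; apply/eqP; field; rewrite gt_eqF.
have := key _ _ a0 a10; have := key _ _ a10 a0; lra.
Qed.

Lemma power_sum_le (k N : nat) : (0 < k)%N ->
  \sum_(k <= j < N) j%:R `^ (- beta) <=
  k%:R `^ (- beta) + k%:R `^ (1 - beta) / (beta - 1).
Proof.
move=> k0; have b0 : 0 < beta - 1 by rewrite subr_gt0.
have [Nk|kN] := leqP N k.
  by rewrite big_geq// addr_ge0 ?divr_ge0 ?powR_ge0// ltW.
rewrite -(subnKC kN); move: (N - k.+1)%N => m.
suff : (beta - 1) * \sum_(k <= j < k.+1 + m) j%:R `^ (- beta) <=
    (beta - 1) * k%:R `^ (- beta) + k%:R `^ (1 - beta) - (k + m)%:R `^ (1 - beta).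
  move=> H; rewrite -(ler_pM2l b0) mulrDr (mulrC _ (_ / _)) divfK ?gt_eqF//.
  by apply: le_trans H _; have := powR_ge0 ((k + m)%:R : R) (1 - beta); lra.
elim: m => [|m IH]; first by rewrite !addn0 big_nat1; lra.
rewrite addnS big_nat_recr/=; last by lia.
have km0 : 0 < (k + m)%:R :> R by rewrite ltr0n; lia.
have := powR_step km0; rewrite natr1 -[(k + m).+1]/(k.+1 + m)%N -addSnnS; lra.
Qed.

Lemma power_sum_ge (k N : nat) : (0 < k <= N)%N ->
  (k%:R `^ (1 - beta) - N%:R `^ (1 - beta)) / (beta - 1) <=
  \sum_(k <= j < N) j%:R `^ (- beta).
Proof.
move=> /andP[k0 kN]; have b0 : 0 < beta - 1 by rewrite subr_gt0.
rewrite ler_pdivrMr//.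
rewrite -(subnKC kN); move: (N - k)%N => m.
elim: m => [|m IH]; first by rewrite addn0 big_geq// subrr mul0r.
rewrite addnS big_nat_recr/=; last by lia.
have km0 : 0 < (k + m)%:R :> R by rewrite ltr0n; lia.
have := powR_step km0; rewrite natr1; lra.
Qed.

End PowerSum.

(** * Uniform counting under the trimming condition *)

Section Condition.
Variables (R : realType) (alpha : R) (k : nat -> nat).
Hypotheses (alpha01 : 0 < alpha < 1) (irr : irrational alpha).
Let q := cf_denom alpha.

Lemma cf_indexP N : (0 < N)%N ->
  (0 < cf_index alpha N)%N /\
  (q (cf_index alpha N) <= N < q (cf_index alpha N).+1)%N.
Proof.
move=> N0.
have ex : exists m, (N < q m)%N.
  exists (N.*2.+1); apply: leq_trans (cf_denom_ge alpha01 irr _) => //=.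
  by rewrite doubleK ltn_expl.
have [m Nm mmin] := ex_minnP ex.
have : exists n, [set n | (q n <= N < q n.+1)%N] n.
  case: m Nm mmin => // m Nm mmin; exists m => /=.
  rewrite Nm andbT leqNgt; apply/negP => /mmin; by rewrite ltnn.
move=> /(xgetPex 0%N); rewrite -/(cf_index alpha N) /= => qNq; split=> //.
by move: qNq; case: (cf_index alpha N) => //=; rewrite /q/=; lia.
Qed.

Definition cf_max N : nat := maxn (cf_quot alpha N)
  (\max_(1 <= j < cf_index alpha N) cf_digit alpha j).

Lemma cf_quot_gt0 N : (0 < N)%N -> (0 < cf_quot alpha N)%N.
Proof.
move=> N0; have [n0 /andP[qN _]] := cf_indexP N0.
by rewrite divn_gt0// cf_denom_gt0.
Qed.

Lemma cf_max_gt0 N : (0 < N)%N -> (0 < cf_max N)%N.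
Proof. by move=> N0; rewrite leq_max cf_quot_gt0. Qed.

Lemma trimming_conditionP : trimming_condition alpha k <->
  forall A : nat, exists N0, forall N, (N0 <= N)%N -> (0 < N)%N ->
    (A * cf_max N <= k N)%N.
Proof.
split=> [/cvgryPge H A|H].
  have [N0 _ HN] := H A%:R; exists N0 => N N0N Ngt0.
  have := HN N N0N => /=; rewrite -/(cf_max N) ler_pdivlMr ?ltr0n ?cf_max_gt0//.
  by rewrite -natrM ler_nat.
apply/cvgryPge => A; have [N0 HN] := H (Num.truncn A).+1.
exists N0.+1 => // N /= N0N; rewrite -/(cf_max N).
have Ngt0 : (0 < N)%N by lia.
rewrite ler_pdivlMr ?ltr0n ?cf_max_gt0//.
have := HN N (ltnW N0N) Ngt0; rewrite -(ler_nat R) natrM; apply: le_trans.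
by rewrite ler_wpM2r// ltW// truncnS_gt.
Qed.

(** With [2^s >= 1 / eps], cutting [2 s + 1] levels leaves blocks of length at
most [q_n / 2^s], that is at most [eps N]; the error [4 M (2 s + 1) + 4] of the
cut levels is at most [(8 s + 8) M], which is small compared with [k]. *)
Lemma visits_uniform (eps : R) : 0 < eps -> trimming_condition alpha k ->
  exists N0, forall N (x t : R), (N0 <= N)%N -> (0 < N)%N -> 0 <= x < 1 -> 0 <= t <= 1 ->
  `|(visits alpha N x t)%:R - t * N%:R| <= eps * ((k N)%:R + t * N%:R).
Proof.
move=> e0 /trimming_conditionP III.
set s := (Num.truncn eps^-1).+1.
have s_eps : 1 <= eps * 2 ^+ s.
  have h : eps^-1 < s%:R by exact: truncnS_gt.
  have h2 : s%:R <= 2 ^+ s :> R by rewrite -natrX ler_nat ltnW// ltn_expl.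
  by rewrite mulrC -ler_pdivrMr// div1r; apply: ltW; apply: lt_le_trans h2.
set u := (Num.truncn ((8 * s + 8)%N%:R / eps)).+1.
have u_eps : (8 * s + 8)%N%:R <= eps * u%:R.
  have h : (8 * s + 8)%N%:R / eps < u%:R by exact: truncnS_gt.
  by rewrite mulrC -ler_pdivrMr// ltW.
have [N0 kM] := III u; exists N0 => N x t N0N Ngt0 x01 t01.
have {}kM := kM N N0N Ngt0; have M0 := cf_max_gt0 Ngt0.
have [n0 /andP[qN Nq]] := cf_indexP Ngt0.
set n := cf_index alpha N in n0 qN Nq; set M := cf_max N in kM M0.
have NM : (N < M.+1 * q n)%N.
  have : (cf_quot alpha N <= M)%N by rewrite leq_max leqnn.
  by rewrite -ltnS ltn_divLR// cf_denom_gt0.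
have aM j : (0 < j < n)%N -> (cf_digit alpha j <= M)%N.
  move=> jn; rewrite leq_max; apply/orP; right.
  by apply: (@leq_bigmax_seq _ _ xpredT) => //; rewrite mem_index_iota.
have NM' : (N < M.+1 * q n)%N || (n == 0%N) by rewrite NM.
have := visits_error alpha01 irr s.*2.+1 Nq NM' aM x01 t01.
move=> /le_trans; apply.
have t0 : 0 <= t by case/andP: t01.
have qs : 2 ^+ s * (q (n.+1 - s.*2.+1))%:R <= N%:R :> R.
  rewrite subSS -natrX -natrM ler_nat; apply: leq_trans qN.
  exact: cf_denom_double.
have h1 : t * (q (n.+1 - s.*2.+1))%:R <= eps * (t * N%:R).
  rewrite mulrCA ler_wpM2l//.
  apply: (@le_trans _ _ (eps * (2 ^+ s * (q (n.+1 - s.*2.+1))%:R))).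
    by rewrite mulrA ler_peMl.
  by rewrite ler_wpM2l// ltW.
have h2 : (4 * M * s.*2.+1)%:R + 4 <= eps * (k N)%:R.
  apply: (@le_trans _ _ (eps * (u * M)%:R)).
    rewrite (natrM _ u) mulrA; apply: (@le_trans _ _ ((8 * s + 8)%:R * M%:R)).
      rewrite -natrM -natrD ler_nat -mul2n.
      have -> : ((8 * s + 8) * M = 4 * M * (2 * s).+1 + 4 * M)%N by ring.
      by rewrite leq_add2l leq_pmulr.
    by rewrite ler_wpM2r.
  by rewrite ler_wpM2l ?ler_nat// ltW.
rewrite mulrDr; lra.
Qed.

End Condition.

(** * The observable *)

Section PowerObs.
Variables (R : realType) (beta : R).
Hypothesis beta1 : 1 < beta.

Lemma power_obs_ge0 y : 0 <= power_obs beta y.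
Proof. by rewrite /power_obs; case: eqP => // _; apply: powR_ge0. Qed.

Lemma power_obsE y : 0 < y -> power_obs beta y = y `^ (- beta).
Proof. by move=> y0; rewrite /power_obs gt_eqF. Qed.

Lemma powRN_le (a b : R) : 0 < a -> a <= b -> b `^ (- beta) <= a `^ (- beta).
Proof.
have b0 : 0 <= beta by apply: ltW; apply: lt_trans beta1.
move=> a0 ab; have bgt0 := lt_le_trans a0 ab.
by rewrite !powRN lef_pV2 ?posrE ?powR_gt0// ge0_ler_powR ?nnegrE// ltW.
Qed.

Lemma powRN_lt (a b : R) : 0 < a -> a < b -> b `^ (- beta) < a `^ (- beta).
Proof.
have b0 : 0 < beta by apply: lt_trans beta1.
move=> a0 ab; have bgt0 := lt_trans a0 ab.
by rewrite !powRN ltf_pV2 ?posrE ?powR_gt0// gt0_ltr_powR ?nnegrE// ltW.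
Qed.

(** The value [0] at [0] makes an orbit point at [0] the smallest term, not the
largest: this is the condition [0 < b]. *)
Lemma power_obs_lt a b : 0 < a -> 0 <= b ->
  (power_obs beta a < power_obs beta b) = (0 < b < a).
Proof.
move=> a0; rewrite le_eqVlt => /predU1P[<-|b0].
  by rewrite ltxx power_obsE// /power_obs eqxx ltNge powR_ge0.
rewrite !power_obsE// b0/=; case: (ltP b a) => ba; first exact: powRN_lt.
by apply/negbTE; rewrite -leNgt powRN_le.
Qed.

Lemma power_obs_inj a b : 0 <= a -> 0 <= b ->
  power_obs beta a = power_obs beta b -> a = b.
Proof.
wlog ab : a b / a <= b.
  by move=> W a0 b0 E; case/orP: (le_total a b) => ab; [|symmetry]; apply: W.
move=> a0 b0 E; apply/eqP; rewrite eq_le ab /= leNgt; apply/negP => {}ab.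
have := power_obs_lt (le_lt_trans a0 ab) a0; rewrite E ltxx ab andbT.
move=> /esym/negbT; rewrite -leNgt => a0'.
have aE : a = 0 by apply/eqP; rewrite eq_le a0' a0.
have := power_obsE (le_lt_trans a0 ab); rewrite -E aE /power_obs eqxx => /eqP.
by rewrite eq_sym gt_eqF// powR_gt0// (le_lt_trans a0 ab).
Qed.

Lemma power_scale (a b c : R) : 0 < a -> 0 < b -> 0 < c ->
  a <= b * c -> c `^ (- beta) <= b `^ beta * a `^ (- beta).
Proof.
move=> a0 b0 c0 abc; have bc0 := mulr_gt0 b0 c0.
have := powRN_le a0 abc; rewrite powRM ?(ltW b0) ?(ltW c0)//.
by rewrite (powRN b) mulrC ler_pdivrMr ?powR_gt0// mulrC.
Qed.

End PowerObs.

(** * Sufficiency of the trimming condition *)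

Section StrongLaw.
Variables (R : realType) (alpha beta : R).
Hypotheses (irr : irrational alpha) (beta1 : 1 < beta).
Variables (N : nat) (x : R).
Hypothesis x01 : 0 <= x < 1.
Let y (i : 'I_N) := iter i (rotation alpha) x.
Let v (i : 'I_N) := power_obs beta (y i).

Lemma orbit_ge0 i : 0 <= y i.
Proof. by case/andP: (iter_rotation_itv alpha i x01). Qed.

Lemma orbit_inj : injective y.
Proof. by move=> i j /(iter_rotation_inj irr x01)/val_inj. Qed.

Lemma orbit_obs_inj : injective v.
Proof.
by move=> i j /(power_obs_inj beta1 (orbit_ge0 i) (orbit_ge0 j))/orbit_inj.
Qed.

(** The larger terms come from the orbit points in [(0, y i)]; the count in
[[0, y i)] may contain one more point, namely [0]. *)
Lemma rank_visits i : 0 < y i ->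
  (rank v i <= visits alpha N x (y i) <= (rank v i).+1)%N.
Proof.
move=> y0.
have rankE : rank v i = #|[set j | 0 < y j < y i]%SET|.
  by apply: eq_card => j; rewrite !finset.in_set power_obs_lt ?orbit_ge0.
have visE : visits alpha N x (y i) = #|[set j | y j < y i]%SET|.
  rewrite /visits -sum1_card [RHS]big_mkcond/=; apply: eq_bigr => j _.
  by rewrite finset.in_set /y; case: (_ < _).
rewrite rankE visE; apply/andP; split.
  by apply: subset_leq_card; apply/fintype.subsetP => j; rewrite !finset.in_set => /andP[].
apply: (@leq_trans #|[set j | 0 < y j < y i]%SET :|: [set j | y j == 0]%SET|).
  apply: subset_leq_card; apply/fintype.subsetP => j.
  rewrite finset.in_setU !finset.in_set => ->.
  by rewrite andbT lt_def orbit_ge0 andbT orNb.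
rewrite (leq_trans (leq_card_setU _ _))// -addn1 leq_add2l.
apply/card_le1_eqP => j l; rewrite !finset.in_set => /eqP j0 /eqP l0.
by apply: orbit_inj; rewrite j0 l0.
Qed.

(** An orbit point at [0] gives the smallest term, so it has the last rank. *)
Lemma orbit_gt0 i : (rank v i < N.-1)%N -> 0 < y i.
Proof.
move=> ri; rewrite lt_def orbit_ge0 andbT; apply/eqP => yi0.
suff : (N.-1 <= rank v i)%N by lia.
have -> : N.-1 = #|[set~ i]%SET| by rewrite cardsC1 card_ord.
apply: subset_leq_card; apply/fintype.subsetP => j; rewrite !finset.in_set => ji.
rewrite /v yi0 {1}/power_obs eqxx power_obsE ?powR_gt0//;
  rewrite lt_def orbit_ge0 andbT; apply: contra ji => /eqP yj0;
  by rewrite finset.in_set1; apply/eqP; apply: orbit_inj; rewrite yi0 yj0.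
Qed.

Variables (k : nat) (rho : R).
Hypotheses (k0 : (0 < k)%N) (kN : (k < N)%N) (rho1 : 1 < rho).
(* The error rate [e = (rho - 1) / (rho + 1)] satisfies [(1 + e) / (1 - e) = rho],
   so that all positions below are determined up to the factor [rho]. *)
Hypothesis vis : forall t : R, 0 <= t <= 1 -> `|(visits alpha N x t)%:R - t * N%:R| <=
  (rho - 1) / (rho + 1) * (k%:R + t * N%:R).

Lemma orbit_rank_bounds i : (k <= rank v i)%N -> 0 < y i ->
  (rank v i)%:R <= rho * (y i * N%:R) /\
  y i * N%:R <= rho * (rank v i).+1%:R.
Proof.
move=> ki y0; have := rank_visits y0; have /andP[_ y1] := iter_rotation_itv alpha i x01.
have /vis : 0 <= y i <= 1 by rewrite ltW//= ltW.
set V := visits _ _ _ _ => H /andP[]; rewrite -!(ler_nat R) -natr1.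
have {}ki : k%:R <= (rank v i)%:R :> R by rewrite ler_nat.
set r := (rank v i)%:R in ki *; move=> rV Vr.
have := rho1 => rho1'.
have rp : 0 < rho + 1 by lra.
move: H; rewrite mulrAC ler_pdivlMr// -{1}(gtr0_norm rp) -normrM ler_norml.
set z := y i * N%:R; have z0 : 0 <= z by rewrite mulr_ge0// ltW.
move=> /andP[H1 H2]; split; nra.
Qed.

Let d := N%:R `^ beta * k%:R `^ (1 - beta) / (beta - 1).

Lemma trimmed_sum_upper :
  trimmed_sum alpha (power_obs beta) k N x <=
  rho `^ beta * d * (1 + (beta - 1) / k%:R).
Proof.
have N0 : 0 < N%:R :> R by rewrite ltr0n; lia.
have kR : 0 < k%:R :> R by rewrite ltr0n.
have rho0 : 0 < rho by apply: lt_trans rho1.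
have b0 : 0 < beta - 1 by rewrite subr_gt0.
rewrite trimmed_sum_rank//; [|exact: ltnW|exact: orbit_obs_inj].
apply: (@le_trans _ _ (\sum_(i < N | (k <= rank v i < N)%N)
    (rho * N%:R) `^ beta * (rank v i)%:R `^ (- beta))).
  rewrite (eq_bigl (fun i => k <= rank v i < N)%N) => [|i]; last first.
    by rewrite ltn_rank andbT.
  apply: ler_sum => i /andP[ki _].
  have [y0|y0] := ltP 0 (y i); last first.
    rewrite /power_obs eq_le y0 orbit_ge0/=.
    by rewrite mulr_ge0 ?powR_ge0.
  rewrite power_obsE//; apply: power_scale => //; rewrite ?mulr_gt0//.
    by rewrite ltr0n (leq_trans k0).
  by rewrite -mulrA (mulrC N%:R); have [] := orbit_rank_bounds ki y0.
rewrite -mulr_sumr (sum_rank orbit_obs_inj (fun j => j%:R `^ (- beta)))//.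
apply: le_trans (ler_wpM2l (powR_ge0 _ _) (power_sum_le beta1 N k0)) _.
rewrite /d powRM ?(ltW rho0) ?(ltW N0)//.
rewrite [k%:R `^ (1 - beta)]powRD ?powRr1 ?(gt_eqF kR) ?implybT//.
rewrite le_eqVlt; apply/orP; left; apply/eqP; field.
by rewrite !gt_eqF.
Qed.

(** Only ranks below [N - 1] are used, since the last term may vanish.  Their
shifted ranks run over [k + 1, ..., N - 1]; the missing term at [k] and the end of
the series at [N] give the two corrections. *)
Lemma trimmed_sum_lower :
  (rho `^ beta)^-1 * d * (1 - (k%:R / N%:R) `^ (beta - 1) - (beta - 1) / k%:R) <=
  trimmed_sum alpha (power_obs beta) k N x.
Proof.
have N0 : 0 < N%:R :> R by rewrite ltr0n; lia.
have kR : 0 < k%:R :> R by rewrite ltr0n.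
have rho0 : 0 < rho by apply: lt_trans rho1.
have b0 : 0 < beta - 1 by rewrite subr_gt0.
rewrite trimmed_sum_rank//; [|exact: ltnW|exact: orbit_obs_inj].
apply: (@le_trans _ _ (\sum_(i < N | (k <= rank v i < N.-1)%N)
    (N%:R / rho) `^ beta * (rank v i).+1%:R `^ (- beta))); last first.
  rewrite [leRHS](bigID (fun i => rank v i < N.-1)%N)/= -[leLHS]addr0.
  apply: lerD; last by apply: sumr_ge0 => i _; exact: power_obs_ge0.
  apply: ler_sum => i /andP[ki iN]; have y0 := orbit_gt0 iN.
  rewrite power_obsE//.
  have := @power_scale _ _ beta1 (y i) (rho / N%:R) (rank v i).+1%:R y0.
  rewrite divr_gt0// ltr0n => /(_ isT isT).
  rewrite mulrAC ler_pdivlMr// => /(_ (orbit_rank_bounds ki y0).2) H.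
  apply: le_trans (ler_wpM2l (powR_ge0 _ _) H) _.
  rewrite mulrA -powRM ?divr_ge0 ?(ltW N0) ?(ltW rho0)//.
  rewrite (_ : N%:R / rho * _ = 1) ?powR1 ?mul1r//.
  by field; rewrite (gt_eqF N0) (gt_eqF rho0).
rewrite -mulr_sumr (sum_rank orbit_obs_inj (fun j => j.+1%:R `^ (- beta))) ?leq_pred//.
rewrite -(big_add1 _ _ _ _ xpredT (fun j => j%:R `^ (- beta))).
have : k%:R `^ (- beta) + \sum_(k.+1 <= j < N) j%:R `^ (- beta) >=
    (k%:R `^ (1 - beta) - N%:R `^ (1 - beta)) / (beta - 1).
  by have := power_sum_ge beta1 (introT andP (conj k0 (ltnW kN))); rewrite big_ltn.
rewrite -lerBlDl => H; apply: le_trans (ler_wpM2l (powR_ge0 _ _) H).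
have NE : N%:R `^ beta * N%:R `^ (1 - beta) = N%:R.
  by rewrite -powRD ?(gt_eqF N0) ?implybT// subrKC powRr1 ?ltW.
have kE : k%:R * k%:R `^ (- beta) = k%:R `^ (1 - beta).
  by rewrite powRD ?(gt_eqF kR) ?implybT// powRr1 ?ltW.
have kNE : (k%:R / N%:R) `^ (beta - 1) * k%:R `^ (1 - beta) = N%:R `^ (1 - beta).
  rewrite powRM ?invr_ge0 ?ltW// -powR_inv1 ?ltW// -powRrM mulN1r opprB mulrAC.
  by rewrite -powRD ?(gt_eqF kR) ?implybT// addrC subrKA subrr powRr0 mul1r.
have -> : (N%:R / rho) `^ beta = N%:R `^ beta * (rho `^ beta)^-1.
  rewrite powRM ?invr_ge0 ?(ltW N0) ?(ltW rho0)//.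
  by rewrite -(powR_inv1 (ltW rho0)) -powRrM mulN1r powRN.
rewrite /d -kNE -kE.
rewrite le_eqVlt; apply/orP; left; apply/eqP; field.
by rewrite !gt_eqF// ?powR_gt0.
Qed.

End StrongLaw.

(** * The strong law *)

Lemma trimmed_strong_law_unifP (R : realType) (alpha : R) f k (d : nat -> R) :
  trimmed_strong_law_unif alpha f k d <->
  forall e : R, 0 < e -> exists N0, forall N (x : R), (N0 <= N)%N -> 0 <= x < 1 ->
    `|trimmed_sum alpha f (k N) N x / d N - 1| < e.
Proof.
rewrite /trimmed_strong_law_unif; split=> [H e e0|H].
  have [|N0 _ HN] := H [set h | forall x : R, 0 <= x < 1 -> `|h x - 1| < e].
    apply/uniform_nbhs; exists [set xy | `|xy.1 - xy.2| < e]; split.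
      exact: entourage_ball (PosNum e0).
    by move=> h /= hE x x01; rewrite distrC; apply: hE; rewrite in_itv.
  by exists N0 => N x N0N; apply: HN.
move=> P /uniform_nbhs [E [entE EP]].
have [e /= e0 eE] : filter_from [set e : R | 0 < e]
    (fun e => [set xy | ball xy.1 e xy.2]) E by rewrite entourage_from_ballE.
have [N0 HN] := H _ e0; exists N0 => // N /= N0N; apply: EP => /= x.
rewrite in_itv => x01; apply: eE; rewrite /ball/= distrC; exact: HN.
Qed.

Lemma trimmed_strong_weak_law (R : realType) (alpha : R) f k (d : nat -> R) :
  trimmed_strong_law_unif alpha f k d -> trimmed_weak_law alpha f k d.
Proof.
move=> /trimmed_strong_law_unifP H eps eps0.
have [N0 HN] := H _ eps0; apply: cvg_near_cst; exists N0 => // N /= N0N.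
rewrite (_ : [set _ | _] = set0) ?measure0//.
apply/seteqP; split => // x /= [x01]; rewrite ltNge; case/negP.
by apply/ltW/HN => //; move: x01; rewrite in_itv.
Qed.

Section TrimmingCondition.
Variables (R : realType) (alpha beta : R) (k : nat -> nat).
Hypotheses (alpha01 : 0 < alpha < 1) (irr : irrational alpha) (beta1 : 1 < beta).
Hypothesis ko : forall eps : R, 0 < eps ->
  exists N0, forall N, (N0 <= N)%N -> (k N)%:R <= eps * N%:R.

Lemma trimming_condition_strong_law (d : nat -> R) :
  trimming_condition alpha k -> positive_seq d ->
  (forall N : nat, (0 < N)%N -> (1 <= k N)%N ->
     d N = (beta - 1)^-1 * N%:R `^ beta * (k N)%:R `^ (1 - beta)) ->
  trimmed_strong_law_unif alpha (power_obs beta) k d.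
Proof.
move=> III d0 dE; apply/trimmed_strong_law_unifP => e0 e0_gt0.
set e := Num.min 1 (e0 / 4).
have egt0 : 0 < e by rewrite lt_min ltr01 divr_gt0.
have e1 : e <= 1 by rewrite ge_min lexx.
have ee0 : 3 * e < e0.
  have : e <= e0 / 4 by rewrite ge_min lexx orbT.
  lra.
have b0 : 0 < beta by apply: lt_trans beta1.
have b1 : 0 < beta - 1 by rewrite subr_gt0.
(* positions known up to [rho] give terms known up to [rho^beta = 1 + e] *)
pose rho := (1 + e) `^ (beta^-1).
have rhoE : rho `^ beta = 1 + e.
  by rewrite /rho -powRrM mulVf ?gt_eqF// powRr1//; lra.
have rho1 : 1 < rho.
  by rewrite -(powRr0 (1 + e)) /rho /powR gt_eqF ?ltr_expR ?mul0r ?mulr_gt0 ?invr_gt0 ?ln_gt0//; lra.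
have eps0 : 0 < (rho - 1) / (rho + 1) by rewrite divr_gt0 ?subr_gt0//; lra.
have [N1 vis] := visits_uniform alpha01 irr eps0 III.
set A := (Num.truncn ((beta - 1) / e)).+1.
have [N2 kA] := (trimming_conditionP k alpha01 irr).1 III A.
pose delta := Num.min 2^-1 (e `^ (beta - 1)^-1).
have delta0 : 0 < delta by rewrite lt_min powR_gt0// andbT; lra.
have [N3 kd] := ko delta0.
exists (N1 + N2 + N3).+1 => N x NN x01.
have {NN} [NN1 NN2 NN3 Ngt0] : [/\ N1 <= N, N2 <= N, N3 <= N & 0 < N]%N.
  by move: NN; clear; split; lia.
have NR : 0 < N%:R :> R by rewrite ltr0n.
have Ak : (A <= k N)%N.
  apply: leq_trans (kA N NN2 Ngt0).
  by rewrite leq_pmulr// cf_max_gt0.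
have k0 : (0 < k N)%N by apply: leq_trans Ak.
have kR : 0 < (k N)%:R :> R by rewrite ltr0n.
have kdN : (k N)%:R <= delta * N%:R by apply: kd.
have kN : (k N < N)%N.
  rewrite -(ltr_nat R); apply: (le_lt_trans kdN).
  have : delta <= 2^-1 by rewrite ge_min lexx.
  by move: NR; nra.
have kNe : ((k N)%:R / N%:R) `^ (beta - 1) <= e.
  apply: (@le_trans _ _ ((e `^ (beta - 1)^-1) `^ (beta - 1))).
    rewrite ge0_ler_powR ?nnegrE ?powR_ge0 ?divr_ge0 ?(ltW b1)//.
    rewrite ler_pdivrMr//; apply: le_trans kdN _.
    by rewrite ler_pM2r// ge_min lexx orbT.
  by rewrite -powRrM mulVf ?gt_eqF// powRr1// ltW.
have ke : (beta - 1) / (k N)%:R <= e.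
  rewrite ler_pdivrMr// mulrC -ler_pdivrMr//.
  by apply: (@le_trans _ _ A%:R); [rewrite ltW// truncnS_gt | rewrite ler_nat].
have ke0 : 0 <= (beta - 1) / (k N)%:R by rewrite divr_ge0// ltW.
have visN (t : R) : 0 <= t <= 1 -> `|(visits alpha N x t)%:R - t * N%:R| <=
    (rho - 1) / (rho + 1) * ((k N)%:R + t * N%:R).
  exact: vis.
have := trimmed_sum_upper irr beta1 x01 k0 kN rho1 visN.
have := trimmed_sum_lower irr beta1 x01 k0 kN rho1 visN.
have -> : N%:R `^ beta * (k N)%:R `^ (1 - beta) / (beta - 1) = d N.
  by rewrite dE// mulrC mulrA.
rewrite rhoE; set T := trimmed_sum _ _ _ _ _; have := d0 N Ngt0.
set D := d N => D0 lo up.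
have up' : T / D <= (1 + e) * (1 + (beta - 1) / (k N)%:R).
  by rewrite ler_pdivrMr// mulrAC.
have lo' : 1 - ((k N)%:R / N%:R) `^ (beta - 1) - (beta - 1) / (k N)%:R <= (1 + e) * (T / D).
  have e10 : 0 < 1 + e by lra.
  rewrite mulrA ler_pdivlMr// mulrC -ler_pdivrMl//.
  by apply: le_trans lo; rewrite mulrA.
move: up' lo' kNe ke ke0 ee0 egt0 e1; clear.
set u := T / D; set a := (_ / _) `^ _; set b := (beta - 1) / _.
move=> up' lo' kNe ke ke0 ee0 egt0 e1.
by apply: le_lt_trans ee0; rewrite ler_norml; apply/andP; split; nra.
Qed.

End TrimmingCondition.

(** * Points whose orbit avoids a neighbourhood of 1 *)

(** Lebesgue measure is built as an outer measure on all subsets, and monotonicity,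
subadditivity and translation are only used at that level: the exceptional sets
of the weak law then need not be shown measurable. *)
Section OuterLebesgue.
Variable R : realType.
Implicit Types (A B : set R).
Let mu : set R -> \bar R := @lebesgue_measure R.

Lemma lebesgue_outer_le A B : A `<=` B -> (mu A <= mu B)%E.
Proof. exact: (le_outer_measure ((@wlength R idfun)^*)%mu). Qed.

Lemma lebesgue_outerU A B : (mu (A `|` B) <= mu A + mu B)%E.
Proof. exact: (@outer_measureU2 _ _ ((@wlength R idfun)^*)%mu). Qed.

Lemma lebesgue_outer_bigU (n : nat) (F : nat -> set R) :
  (mu (\big[setU/set0]_(i < n) F i) <= \sum_(i < n) mu (F i))%E.
Proof. exact: (@outer_measure_subadditive _ _ ((@wlength R idfun)^*)%mu). Qed.

(** Covers by half-open intervals translate, with the same lengths. *)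
Lemma lebesgue_outer_translate A (c : R) : (mu [set x | A (x + c)%R] <= mu A)%E.
Proof.
apply: ereal_inf_le_tmp => _ /= [F [mF AF] <-].
exists (fun k => [set x | F k (x + c)]).
  split=> [i|x /= /AF[k _ Fk]]; last by exists k.
  have [[a b] _ /= <-] := mF i; exists (a - c, b - c) => //=.
  by apply/seteqP; split => x /=; rewrite !in_itv/= ltrBlDr lerBrDr.
apply: eq_eseriesr => i _; have [[a b] _ /= <-] := mF i.
have -> : [set x | `]a, b]%classic (x + c)] = `]a - c, b - c]%classic.
  by apply/seteqP; split => x /=; rewrite !in_itv/= ltrBlDr lerBrDr.
rewrite !wlength_itv/= !lte_fin ltrD2r; case: ifP => // _.
by rewrite -!EFinB; congr (_%:E); ring.
Qed.

End OuterLebesgue.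

Section Avoiding.
Variables (R : realType) (alpha : R).
Hypotheses (alpha01 : 0 < alpha < 1) (irr : irrational alpha).
Let mu : set R -> \bar R := @lebesgue_measure R.
Let q := cf_denom alpha.

(** Write [i = l q_n + j] with [l < b].  Since [q_n alpha] is an integer plus or
minus the gap, the [i]-th point is the [j]-th point moved by [l] gaps in a
direction given by the parity of [n].  So if it falls in [[1 - Delta, 1)] or at
[0], then [x + j alpha] is modulo [1] in an interval that depends only on [j], of
length [Delta] plus the length [(b - 1) gap_n] of a cluster. *)
Lemma orbit_near_one (n b i : nat) (x Delta : R) : (0 < n)%N -> 0 <= x < 1 ->
  (i < b * q n)%N -> 0 <= Delta < 1 ->
  iter i (rotation alpha) x = 0 \/ 1 - Delta <= iter i (rotation alpha) x ->
  exists z : int, - (Delta + b.-1%:R * cf_gap alpha n) <=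
    x + (i %% q n)%:R * alpha - (if odd n then 0 else b.-1%:R * cf_gap alpha n) - z%:~R <= 0.
Proof.
move=> n0 x01 ib /andP[D0 D1] near.
set G := cf_gap alpha n; have G0 : 0 < G := cf_gap_gt0 alpha01 irr n.
set l := (i %/ q n)%N; set j := (i %% q n)%N.
have lb : (l <= b.-1)%N.
  suff : (l < b)%N by lia.
  by rewrite ltn_divLR// cf_denom_gt0.
have iE : i%:R = l%:R * (q n)%:R + j%:R :> R.
  by rewrite -natrM -natrD -divn_eq.
have [w [w0 wD]] : exists w : int, x + i%:R * alpha - w%:~R <= 0 /\
    - Delta <= x + i%:R * alpha - w%:~R.
  have /andP[y0 y1] := iter_rotation_itv alpha i x01.
  move: near y0 y1; rewrite iter_rotationE// /frac_part.
  set u := x + i%:R * alpha; set f := Num.floor u.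
  case=> near y0 y1; [exists f|exists (f + 1)]; rewrite ?intrD; split=> //; lra.
exists (w - (l * cf_numer alpha n)%N%:Z)%R; rewrite intrB -!pmulrn natrM.
have := cf_gapE alpha01 irr n; rewrite -/G -/q => gE.
have {iE} iE : i%:R * alpha = j%:R * alpha + l%:R * (cf_numer alpha n)%:R +
    l%:R * ((-1) ^+ n.+1 * G) by rewrite -gE iE; ring.
have lG : l%:R * G <= b.-1%:R * G by rewrite ler_pM2r// ler_nat.
have lG0 : 0 <= l%:R * G by rewrite mulr_ge0// ltW.
move: iE w0 wD; rewrite -signr_odd/=; case: (odd n) => /= -> w0 wD; lra.
Qed.

(** The bad points are covered by three intervals for each of the [q_n] clusters,
of total length at most [1/2]; the sets [E] and [E - Delta] have total measure
less than [1/2], so the three together cannot cover [[0, 1)]. *)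
Lemma avoiding_point (n b : nat) (Delta : R) (E : set R) : (0 < n)%N ->
  0 < Delta -> 6 * (q n)%:R * (Delta + b.-1%:R * cf_gap alpha n) <= 1 ->
  (mu E < (4^-1)%:E)%E ->
  exists x : R, [/\ 0 <= x < 1, ~ E x, ~ E (x + Delta) &
    forall i, (i < b * q n)%N -> 0 < iter i (rotation alpha) x < 1 - Delta].
Proof.
move=> n0 D0 W6 muE; apply: contrapT => nex.
set G := cf_gap alpha n in W6; have G0 : 0 < G := cf_gap_gt0 alpha01 irr n.
set W := Delta + b.-1%:R * G in W6.
have bG0 : 0 <= b.-1%:R * G by rewrite mulr_ge0// ltW.
have q1 : 1 <= (q n)%:R :> R by rewrite ler1n cf_denom_gt0.
have W0 : 0 < W by rewrite /W; lra.
have W1 : W < 1 by move: W6 q1 W0; clear; nra.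
pose h := if odd n then 0 else b.-1%:R * G.
pose c j : R := j%:R * alpha - h.
pose J j e : set R := `[(Num.floor (c j))%:~R + e%:R - c j - W,
                (Num.floor (c j))%:~R + e%:R - c j]%classic.
pose Bad : set R := \big[setU/set0]_(j < q n) \big[setU/set0]_(e < 3) J j e.
have cover : `[0, 1[%classic `<=` (E `|` [set x | E (x + Delta)]) `|` Bad.
  move=> x /=; rewrite in_itv/= => x01.
  have [|nE] := pselect (E x); first by left; left.
  have [|nED] := pselect (E (x + Delta)); first by left; right.
  have [i [ib near]] : exists i, (i < b * q n)%N /\
      (iter i (rotation alpha) x = 0 \/ 1 - Delta <= iter i (rotation alpha) x).
    apply: contrapT => nobad; apply: nex; exists x; split=> // i ib.
    have /andP[y0 y1] := iter_rotation_itv alpha i x01.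
    rewrite lt_def y0 andbT ltNge; apply/andP; split.
      by apply/eqP => yi; apply: nobad; exists i; split=> //; left.
    by apply/negP => yi; apply: nobad; exists i; split=> //; right.
  have D01 : 0 <= Delta < 1 by rewrite ltW//=; move: W1; rewrite /W; lra.
  have [z /andP[z1 z2]] := orbit_near_one n0 x01 ib D01 near.
  right; set j := (i %% q n)%N in z1 z2.
  have jq : (j < q n)%N by rewrite ltn_mod cf_denom_gt0.
  have {}z1 : - W <= x + c j - z%:~R by move: z1; rewrite /c /h /W /G; lra.
  have {}z2 : x + c j - z%:~R <= 0 by move: z2; rewrite /c /h /G; lra.
  have /andP[x0 x1] := x01; have /andP[f0 f1] := floor_itv (c j).
  set fl := Num.floor (c j) in f0 f1; rewrite intrD in f1.
  (* [z] lies in [[x + c j, x + c j + W]], hence between [fl] and [fl + 2] *)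
  have [e e3 zE] : exists2 e : nat, (e < 3)%N & z = fl + e%:Z.
    have [] : (-1 < z - fl)%R /\ (z - fl < 3)%R.
      by rewrite -!(ltr_int R) intrB; split; lra.
    by move: (fl) => v; clear; exists `|z - v|%N; lia.
  rewrite /Bad -(bigcup_mkord _ (fun j => \big[setU/set0]_(e < 3) J j e)).
  exists j => //; rewrite -(bigcup_mkord _ (fun e => J j e)); exists e => //.
  move: z1 z2; rewrite zE intrD -pmulrn /J/= in_itv/= -/fl => z1 z2.
  by apply/andP; split; lra.
have muJ j e : mu (J j e) = W%:E.
  rewrite /mu lebesgue_measure_itv/= lte_fin ifT; last by lra.
  by rewrite -EFinB; congr (_%:E); lra.
have muBad : (mu Bad <= (2^-1)%:E)%E.
  apply: le_trans
    (@lebesgue_outer_bigU R (q n) (fun j => \big[setU/set0]_(e < 3) J j e)) _.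
  apply: (@le_trans _ _ (\sum_(j < q n) (3 * W)%:E)%E).
    apply: lee_sum => j _; apply: le_trans (@lebesgue_outer_bigU R 3 (J j)) _.
    rewrite (eq_bigr (fun=> W%:E)) => [|e _]; last exact: muJ.
    by rewrite sumEFin lee_fin sumr_const card_ord; lra.
  by rewrite sumEFin lee_fin sumr_const card_ord -mulr_natl; lra.
have := lebesgue_outer_le cover.
have -> : @lebesgue_measure R `[0, 1[%classic = 1%:E.
  by rewrite lebesgue_measure_itv/= lte_fin ltr01 oppr0 adde0.
apply/negP; rewrite -ltNge.
apply: le_lt_trans (lebesgue_outerU _ _) _.
apply: (@le_lt_trans _ _ (mu E + mu E + (2^-1)%:E)%E).
  apply: leeD => //; apply: le_trans (lebesgue_outerU _ _) _.
  by apply: leeD => //; apply: lebesgue_outer_translate.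
apply: (@lt_le_trans _ _ ((4^-1)%:E + (4^-1)%:E + (2^-1)%:E)%E).
  by rewrite lteD2rE// lteD.
by rewrite -!EFinD lee_fin; lra.
Qed.

End Avoiding.

(** * Fluctuation of undertrimmed sums *)

Lemma iter_rotation_shift (R : realType) (alpha x Delta : R) i :
  0 <= x < 1 -> 0 <= Delta -> x + Delta < 1 ->
  iter i (rotation alpha) x < 1 - Delta ->
  iter i (rotation alpha) (x + Delta) = iter i (rotation alpha) x + Delta.
Proof.
move=> x01 D0 xD yD; have /andP[y0 y1] := iter_rotation_itv alpha i x01.
rewrite [LHS]iter_rotationE; last by rewrite xD andbT addr_ge0//; case/andP: x01.
apply: (@frac_part_eq _ _ _ (Num.floor (x + i%:R * alpha))); first by lra.
by rewrite [in RHS]iter_rotationE// /frac_part; ring.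
Qed.

Section Fluctuation.
Variables (R : realType) (alpha beta : R).
Hypotheses (alpha01 : 0 < alpha < 1) (irr : irrational alpha) (beta1 : 1 < beta).
Let q := cf_denom alpha.
Variables (n b : nat) (x : R).
Hypotheses (n0 : (0 < n)%N) (x01 : 0 <= x < 1).
Let Q : R := (q n)%:R.
Let y i := iter i (rotation alpha) x.

(** A cell has [b] points on average, and each of its two ends contributes an
error of [4 b]. *)
Lemma card_orbit_cell m : (m < q n)%N ->
  (#|[set i : 'I_(b * q n) | Num.truncn (Q * y i) == m]%SET| <= 9 * b)%N.
Proof.
move=> mq; have Q0 : 0 < Q by rewrite ltr0n cf_denom_gt0.
have t01 (j : nat) : (j <= q n)%N -> 0 <= j%:R / Q <= 1.
  by move=> jq; rewrite divr_ge0 ?ler0n//= ler_pdivrMr// mul1r ler_nat.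
have lo := visits_denom_multiple alpha01 irr b n0 x01 (t01 m (ltnW mq)).
have hi := visits_denom_multiple alpha01 irr b n0 x01 (t01 m.+1 mq).
have split_visits : (#|[set i : 'I_(b * q n) | Num.truncn (Q * y i) == m]%SET| +
    visits alpha (b * q n) x (m%:R / Q) <= visits alpha (b * q n) x (m.+1%:R / Q))%N.
  rewrite /visits -sum1_card big_mkcond -big_split/=; apply: leq_sum => i _.
  have /andP[y0 _] := iter_rotation_itv alpha i x01.
  have Qy0 : 0 <= Q * y i by rewrite mulr_ge0// ltW.
  rewrite finset.in_set -/(y i) !ltr_pdivlMr// ![_ * Q]mulrC.
  case: eqP => [<-|_].
    have /andP[h1 ->] := truncn_itv Qy0.
    by rewrite ltNge h1.
  rewrite add0n; case: (ltP (Q * y i) m%:R) => //= h.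
  by rewrite (lt_le_trans h)// ler_nat.
move: split_visits lo hi; rewrite -(ler_nat R) natrD -[in X in _ -> X](ler_nat R) !natrM.
rewrite -/q -/Q !mulrA !(mulrAC _ Q^-1) => s lo hi.
move: lo hi; rewrite !mulfK ?gt_eqF// !ler_norml -natr1; move: s; lra.
Qed.

(** The [m]-th cell contributes at most [9 b] terms of size [(q_n / m)^beta], and
the series over [m >= 1] converges. *)
Lemma far_sum_le :
  \sum_(i < b * q n | 1 <= Q * y i) power_obs beta (y i) <=
  9 * b%:R * Q `^ beta * (1 + (beta - 1)^-1).
Proof.
have Q0 : 0 < Q by rewrite ltr0n cf_denom_gt0.
have y01 i : 0 <= y i < 1 := iter_rotation_itv alpha i x01.
have Qy0 i : 0 <= Q * y i by rewrite mulr_ge0 ?(ltW Q0)//; case/andP: (y01 i).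
have cell i : (Num.truncn (Q * y i) < q n)%N.
  have /andP[h _] := truncn_itv (Qy0 i).
  rewrite -(ltr_nat R) (le_lt_trans h)// -[ltRHS]mulr1 ltr_pM2l//.
  by case/andP: (y01 i).
pose s (i : 'I_(b * q n)) := Ordinal (cell i).
pose F (m : nat) : R := Q `^ beta * m%:R `^ (- beta).
have F0 m : 0 <= F m by rewrite mulr_ge0 ?powR_ge0.
apply: (@le_trans _ _ (\sum_(i < b * q n | (0 < s i)%N) F (s i))).
  rewrite [leLHS]big_mkcond [leRHS]big_mkcond/=; apply: ler_sum => i _.
  have /andP[h1 h2] := truncn_itv (Qy0 i).
  case: ifPn => Qy1; last by case: ifP.
  have m0 : (0 < Num.truncn (Q * y i))%N by rewrite truncn_gt0.
  rewrite m0 power_obsE; last by rewrite -(pmulr_rgt0 _ Q0); apply: lt_le_trans Qy1.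
  have yi0 : 0 < y i by rewrite -(pmulr_rgt0 _ Q0); apply: lt_le_trans Qy1.
  by apply: power_scale => //; rewrite ltr0n.
rewrite (partition_big s (fun j : 'I_(q n) => (0 < j)%N))//=.
apply: (@le_trans _ _ (\sum_(j < q n | (0 < j)%N) (9 * b)%:R * F j)).
  apply: ler_sum => j j0.
  rewrite (eq_bigr (fun=> F j)) => [|i /andP[_ /eqP <-]//].
  rewrite sumr_const -[leLHS]mulr_natl ler_wpM2r// ler_nat.
  apply: leq_trans (card_orbit_cell (ltn_ord j)).
  apply: subset_leq_card; apply/fintype.subsetP => i.
  by rewrite finset.in_set => /andP[_ /eqP <-].
rewrite -mulr_sumr -mulr_sumr natrM -!mulrA ler_wpM2l// ler_wpM2l// ler_wpM2l ?powR_ge0//.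
rewrite -(big_geq_mkord 1%N _ xpredT (fun j => j%:R `^ (- beta))).
apply: le_trans (power_sum_le beta1 _ _) _ => //.
by rewrite !powR1 mul1r.
Qed.

Variables (C kk : nat).
Hypotheses (b0 : (0 < b)%N) (kC : (kk <= C * b)%N) (Cq : (C + 5 <= q n)%N).
Let Delta : R := (12 * Q)^-1.
Hypothesis avoid : forall i, (i < b * q n)%N -> 0 < y i < 1 - Delta.
Let A : R := (C + 5)%:R.

(** [[0, A / q_n)] contains at least [(A - 4) b] points, which is at least [b] more
than the [C b] that may have been trimmed. *)
Lemma near_sum_ge (Z : {set 'I_(b * q n)}) : #|~: Z| = kk ->
  b%:R * (Q `^ beta * A `^ (- beta)) <=
  \sum_(i in Z | Q * y i < A) power_obs beta (y i).
Proof.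
move=> Zk; have Q0 : 0 < Q by rewrite ltr0n cf_denom_gt0.
have A0 : 0 < A by rewrite ltr0n addnS.
have AQ : A <= Q by rewrite ler_nat.
have t01 : 0 <= A / Q <= 1 by rewrite divr_ge0 ?(ltW A0) ?(ltW Q0)//= ler_pdivrMr// mul1r.
have vis : visits alpha (b * q n) x (A / Q) =
    #|[set i : 'I_(b * q n) | Q * y i < A]%SET|.
  rewrite /visits -sum1_card [RHS]big_mkcond/=; apply: eq_bigr => j _.
  by rewrite finset.in_set -/(y j) ltr_pdivlMr// mulrC; case: (_ < _).
have : (#|[set i : 'I_(b * q n) | (Q * y i < A)%R]%SET| <=
    #|Z :&: [set i : 'I_(b * q n) | (Q * y i < A)%R]%SET| + kk)%N.
  set S := [set i | _]%SET.
  rewrite -(cardsID Z S) finset.setIC -Zk leq_add2l finset.setDE.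
  by apply: subset_leq_card; exact: finset.subsetIr.
have := visits_denom_multiple alpha01 irr b n0 x01 t01.
rewrite vis natrM mulrA mulrAC divfK ?gt_eqF//.
set c1 := #|_|; set c2 := #|_| => lo c12.
have bc : (b <= c2)%N.
  rewrite -(ler_nat R).
  move: lo; rewrite ler_norml => /andP[lo _].
  have : c1%:R <= c2%:R + kk%:R :> R by rewrite -natrD ler_nat.
  have : kk%:R <= C%:R * b%:R :> R by rewrite -natrM ler_nat.
  by move: lo; rewrite /A natrD; lra.
apply: (@le_trans _ _ (c2%:R * (Q `^ beta * A `^ (- beta)))).
  by rewrite ler_wpM2r ?ler_nat// mulr_ge0 ?powR_ge0.
rewrite mulr_natl -sumr_const [leLHS](eq_bigl (fun i => (i \in Z) && (Q * y i < A))).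
  apply: ler_sum => i /andP[_ yA].
  have /andP[yi0 _] := avoid (ltn_ord i).
  rewrite power_obsE//.
  have -> : Q `^ beta * A `^ (- beta) = (A / Q) `^ (- beta).
    rewrite powRM ?(ltW A0) ?invr_ge0 ?(ltW Q0)// mulrC; congr (_ * _).
    by rewrite -(powR_inv1 (ltW Q0)) -powRrM mulN1r opprK.
  by apply: powRN_le => //; rewrite ler_pdivlMr// mulrC ltW.
by move=> i; rewrite finset.in_setI finset.in_set.
Qed.

(** A shift by [Delta] multiplies the terms of points below [A / q_n] by at most
[theta = (1 + 1 / (12 A))^-beta], and the remaining terms sum to at most
[K = 9 (1 + 1 / (beta - 1)) A^beta] times these.  The value solves
[1 - theta = loss (1 + K)]. *)
Definition shift_loss : R :=
  (1 - (1 + (12 * A)^-1) `^ (- beta)) / (1 + 9 * (1 + (beta - 1)^-1) * A `^ beta).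

Lemma shift_loss_gt0 : 0 < shift_loss.
Proof.
have A0 : 0 < A by rewrite ltr0n addnS.
have b1 : 0 < beta - 1 by rewrite subr_gt0.
rewrite divr_gt0//.
  have := @powRN_lt _ _ beta1 1 (1 + (12 * A)^-1) ltr01.
  by rewrite powR1 subr_gt0; apply; rewrite ltrDl invr_gt0 mulr_gt0.
by rewrite addr_gt0// !mulr_gt0 ?powR_gt0// addr_gt0 ?invr_gt0.
Qed.

Lemma shift_loss_lt1 : shift_loss < 1.
Proof.
have A0 : 0 < A by rewrite ltr0n addnS.
have K0 : 0 < 9 * (1 + (beta - 1)^-1) * A `^ beta.
  by rewrite !mulr_gt0 ?powR_gt0// addr_gt0 ?invr_gt0 ?subr_gt0.
have th0 : 0 < (1 + (12 * A)^-1) `^ (- beta).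
  by rewrite powR_gt0// addr_gt0// invr_gt0 mulr_gt0.
by rewrite /shift_loss ltr_pdivrMr; lra.
Qed.

(** The shifted orbit is compared term by term with the original one, trimming the
same indices: these are optimal at [x], and trimming them at [x + Delta] can only
give a larger sum than the optimal choice there. *)
Lemma trimmed_sum_shift : (kk <= b * q n)%N ->
  trimmed_sum alpha (power_obs beta) kk (b * q n) (x + Delta) <=
  (1 - shift_loss) * trimmed_sum alpha (power_obs beta) kk (b * q n) x.
Proof.
move=> kN; have Q0 : 0 < Q by rewrite ltr0n cf_denom_gt0.
have A0 : 0 < A by rewrite ltr0n addnS.
have b1 : 0 < beta - 1 by rewrite subr_gt0.
have D0 : 0 < Delta by rewrite invr_gt0 mulr_gt0.
have N0 : (0 < b * q n)%N by rewrite muln_gt0 b0 cf_denom_gt0.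
have xD : x + Delta < 1 by have /andP[_] := avoid N0; rewrite /y/=; lra.
have [B Bk [-> _]] := trimmed_sum_max alpha (power_obs beta) x kN.
set Z := ~: B.
have Zk : #|~: Z| = kk by rewrite finset.setCK.
apply: (@le_trans _ _ (\sum_(i in Z) power_obs beta (y i + Delta))).
  have := trimmed_sum_le alpha (power_obs beta) B (x + Delta).
  rewrite Bk => /le_trans; apply; apply: ler_sum => i _.
  rewrite iter_rotation_shift//; first exact: ltW.
  by case/andP: (avoid (ltn_ord i)).
pose theta := (1 + (12 * A)^-1) `^ (- beta).
rewrite (bigID (fun i : 'I_(b * q n) => Q * y i < A))/=.
rewrite [X in _ * X](bigID (fun i : 'I_(b * q n) => Q * y i < A))/=.
set L' := (X in X + _ <= _); set U' := (X in _ + X <= _).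
set L := (X in _ * (X + _)); set U := (X in _ * (_ + X)).
have L'L : L' <= theta * L.
  rewrite /L mulr_sumr; apply: ler_sum => i /andP[_ yA].
  have /andP[yi0 _] := avoid (ltn_ord i).
  rewrite !power_obsE ?addr_gt0// /theta -powRM ?(ltW yi0)//; last first.
    by rewrite addr_ge0// invr_ge0 mulr_ge0// ltW.
  apply: powRN_le => //; first by rewrite mulr_gt0// addr_gt0// invr_gt0 mulr_gt0.
  rewrite mulrDl mul1r lerD2l ler_pdivrMl ?mulr_gt0//.
  by rewrite /Delta ler_pdivlMr ?mulr_gt0// -/(y i); move: yA; lra.
have U'U : U' <= U.
  apply: ler_sum => i _; have /andP[yi0 _] := avoid (ltn_ord i).
  by rewrite !power_obsE ?addr_gt0//; apply: powRN_le => //; rewrite lerDl ltW.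
have Lge : b%:R * (Q `^ beta * A `^ (- beta)) <= L := near_sum_ge Zk.
have Ule : U <= 9 * b%:R * Q `^ beta * (1 + (beta - 1)^-1).
  apply: le_trans far_sum_le; rewrite /U [leRHS]big_mkcond [leLHS]big_mkcond/=.
  apply: ler_sum => i _; rewrite -leNgt; case: ifPn => [/andP[_ Ay]|_].
    rewrite ifT//; apply: le_trans Ay; by rewrite ler1n addnS.
  by case: ifP => // _; exact: power_obs_ge0.
have UL : U <= 9 * (1 + (beta - 1)^-1) * A `^ beta * L.
  apply: le_trans Ule _.
  apply: (@le_trans _ _
      (9 * (1 + (beta - 1)^-1) * A `^ beta * (b%:R * (Q `^ beta * A `^ (- beta))))).
    rewrite le_eqVlt; apply/orP; left; apply/eqP.
    rewrite [A `^ (- beta)]powRN; field.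
    by rewrite (gt_eqF b1) gt_eqF// powR_gt0.
  by rewrite ler_wpM2l// !mulr_ge0 ?powR_ge0// addr_ge0// invr_ge0 ltW.
have := shift_loss_gt0; rewrite /shift_loss -/theta.
set K := 9 * _ * _ in UL *.
have K0 : 0 < 1 + K.
  by rewrite addr_gt0// !mulr_gt0 ?powR_gt0// addr_gt0 ?invr_gt0.
set eta := _ / _ => eta0.
have etaE : 1 - theta = eta * (1 + K) by rewrite /eta divfK// gt_eqF.
apply: (le_trans (lerD L'L U'U)).
have : eta * U <= eta * (K * L) by rewrite ler_wpM2l// ltW.
have -> : theta = 1 - eta * (1 + K) by rewrite -etaE; ring.
lra.
Qed.

End Fluctuation.

(** * Necessity of the trimming condition *)

Section WeakLaw.
Variables (R : realType) (alpha beta : R) (k : nat -> nat).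
Hypotheses (alpha01 : 0 < alpha < 1) (irr : irrational alpha) (beta1 : 1 < beta).
Hypotheses (hk : trimming_sequence k) (hmono : monotone_seq k).
Let q := cf_denom alpha.

Lemma undertrimmed_bounded (K : nat) : (forall N, (0 < N)%N -> (k N <= K)%N) ->
  exists C, forall n0, exists n b, [/\ (n0 <= n)%N, (0 < n)%N, (0 < b)%N,
    (12 * b.-1 <= cf_digit alpha n)%N & (k (b * q n) <= C * b)%N].
Proof.
move=> kK; exists K => n0; exists n0.+1, 1%N; split=> //.
by rewrite mul1n muln1 kK// cf_denom_gt0.
Qed.

Lemma cf_quot_digit N : (0 < N)%N ->
  (cf_quot alpha N <= cf_digit alpha (cf_index alpha N))%N.
Proof.
move=> N0; have [] := cf_indexP alpha01 irr N0.
rewrite /cf_quot; case: (cf_index alpha N) => // n _ /andP[qN].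
have qn0 := cf_denom_gt0 alpha01 irr (ltn0Sn n).
move=> Nq; rewrite -ltnS ltn_divLR//; apply: leq_trans Nq _.
by rewrite cf_denomSS mulSn addnC leq_add2r cf_denom_le.
Qed.

(** The maximum is either the last quotient [b_n], with [b_n q_n <= N], or a digit
[a_j] with [j < n], and then [a_j q_j <= q_(j+1) <= N].  Both cases say that [c]
blocks of length [q_n] fit into [N]. *)
Lemma cf_max_attained N A : (0 < N)%N -> (k N < A * cf_max alpha N)%N ->
  exists n c, [/\ (0 < n)%N, (c <= cf_digit alpha n)%N, (c * q n <= N)%N &
    (k N < A * c)%N].
Proof.
move=> N0 kA; have [n0 /andP[qN Nq]] := cf_indexP alpha01 irr N0.
have [kb|kb] := ltnP (k N) (A * cf_quot alpha N).
  exists (cf_index alpha N), (cf_quot alpha N); split=> //; first exact: cf_quot_digit.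
  exact: leq_trunc_div.
apply: contrapT => nex; move: kA; apply/negP; rewrite -leqNgt.
case: A => // A in kb nex *.
rewrite mulnC -leq_divRL// geq_max leq_divRL// mulnC kb/=.
apply/bigmax_leqP_seq => j; rewrite mem_index_iota => /andP[j0 jn] _.
rewrite leq_divRL// mulnC leqNgt; apply/negP => kj; apply: nex.
exists j, (cf_digit alpha j); split=> //.
apply: leq_trans qN; apply: leq_trans (cf_denom_le alpha01 irr jn).
by case: j j0 {jn kj} => // j _; rewrite /q cf_denomSS leq_addr.
Qed.

(** Dividing the number [c] of blocks by [12] makes the clusters short compared
with their spacing.  It does not hurt the bound on [k]: the new time is earlier,
so [k] is not larger there when [k] is nondecreasing.  If [k] is unbounded, [c]
must be large, which pushes [n] to infinity; if [k] is bounded, in particular if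
it is nonincreasing, single blocks [b = 1] will do. *)
Lemma undertrimmed_scales : ~ trimming_condition alpha k ->
  exists C, forall n0, exists n b, [/\ (n0 <= n)%N, (0 < n)%N, (0 < b)%N,
    (12 * b.-1 <= cf_digit alpha n)%N & (k (b * q n) <= C * b)%N].
Proof.
move=> nIII; case: hmono => [inc|dec]; last first.
  by apply: (@undertrimmed_bounded (k 1)) => N N0; apply: dec.
have [[K kK]|unb] := pselect (exists K, forall N, (0 < N)%N -> (k N <= K)%N).
  exact: undertrimmed_bounded kK.
have [A HA] : exists A, forall N0, exists N, [/\ (N0 <= N)%N, (0 < N)%N &
    (k N < A * cf_max alpha N)%N].
  apply: contrapT => nA; apply: nIII; apply/trimming_conditionP => // A.
  apply: contrapT => nN0; apply: nA; exists A => N0.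
  apply: contrapT => nN; apply: nN0; exists N0 => N N0N Ngt0.
  by rewrite leqNgt; apply/negP => kN; apply: nN; exists N.
exists (12 * A)%N => n0.
have [M [M0 kM]] : exists M, (0 < M)%N /\ (A * q n0 < k M)%N.
  apply: contrapT => nM; apply: unb; exists (A * q n0)%N => N Ngt0.
  by rewrite leqNgt; apply/negP => kN; apply: nM; exists N.
have [N [MN N0 kN]] := HA M.
have [n [c [ngt0 ca cN kc]]] := cf_max_attained N0 kN.
have c0 : (0 < c)%N by case: c kc {ca cN} => //; rewrite muln0.
exists n, ((c + 11) %/ 12)%N.
have b0 : (0 < (c + 11) %/ 12)%N by rewrite divn_gt0//; lia.
have qn0 := cf_denom_gt0 alpha01 irr ngt0.
have bc : ((c + 11) %/ 12 <= c)%N by lia.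
split=> //; last first.
- apply: (@leq_trans (k N)).
    apply: inc; first by rewrite muln_gt0 b0.
    by apply: leq_trans cN; rewrite leq_mul2r bc orbT.
  by apply: leq_trans (ltnW kc) _; rewrite (mulnC 12%N) -mulnA leq_mul2l; apply/orP; right; lia.
- by apply: leq_trans ca; lia.
rewrite leqNgt; apply/negP => nn0.
have qc : (q n0 < c)%N.
  have : (A * q n0 < A * c)%N.
    by apply: ltn_trans kM _; apply: leq_ltn_trans kc; apply: inc.
  by rewrite ltn_mul2l => /andP[].
suff : (c <= q n0)%N by rewrite leqNgt qc.
apply: leq_trans (cf_denom_le alpha01 irr nn0).
case: n ngt0 ca qn0 {cN nn0} => // n _ ca qn0; rewrite cf_denomSS.
by apply: leq_trans (leq_addr _ _); apply: leq_trans ca _; rewrite leq_pmulr.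
Qed.

(** The tolerance [eta / 4] is small enough that a decrease by the factor
[1 - eta] leads from the upper to below the lower bound. *)
Lemma weak_law_trimming_condition (d : nat -> R) : positive_seq d ->
  trimmed_weak_law alpha (power_obs beta) k d -> trimming_condition alpha k.
Proof.
move=> d0 weak; apply: contrapT => /undertrimmed_scales[C HC].
set eta := shift_loss beta C.
have eta0 : 0 < eta := shift_loss_gt0 beta1 C.
have eta4 : 0 < eta / 4 by rewrite divr_gt0.
pose E N := [set x : R | `[0, 1[%classic x /\
        eta / 4 < `|trimmed_sum alpha (power_obs beta) (k N) N x / d N - 1|].
have [N0 HN] : exists N0, forall N, (N0 <= N)%N ->
    (@lebesgue_measure R (E N) < (4^-1)%:E)%E.
  have : nbhs (0%:E : \bar R) [set y : \bar R | (y < (4^-1)%:E)%E].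
    by apply: open_nbhs_nbhs; split; [exact: open_ereal_lt_ereal | rewrite /= lte_fin].
  by move=> /(weak _ eta4)[N0 _ H]; exists N0 => N /H.
(* [q_n >= 2^((n - 1) / 2)] turns this bound on [n] into [q_n >= N0 + C + 5] *)
have [n [b [nn n0 b0 ba kC]]] := HC (2 * (N0 + C + 5)).+1%N.
set Nn := (b * q n)%N in kC.
have qbig : (N0 + C + 5 <= q n)%N.
  apply: leq_trans (cf_denom_le alpha01 irr nn).
  apply: leq_trans (cf_denom_ge alpha01 irr _) => //=.
  by rewrite mul2n doubleK ltnW// ltn_expl.
have N0N : (N0 <= Nn)%N.
  apply: (@leq_trans (q n)); first by apply: leq_trans qbig; lia.
  by rewrite leq_pmull.
have Cq : (C + 5 <= q n)%N by apply: leq_trans qbig; lia.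
have qn0 := cf_denom_gt0 alpha01 irr n0.
have Nn0 : (0 < Nn)%N by rewrite muln_gt0 b0.
set Q : R := (q n)%:R; have Q0 : 0 < Q by rewrite ltr0n.
pose Delta : R := (12 * Q)^-1.
have D0 : 0 < Delta by rewrite invr_gt0 mulr_gt0.
have W6 : 6 * Q * (Delta + b.-1%:R * cf_gap alpha n) <= 1.
  have gap := cf_gap_le alpha01 irr n.
  have g0 := cf_gap_gt0 alpha01 irr n.
  have aq : (12 * b.-1)%:R * Q <= (cf_denom alpha n.+1)%:R :> R.
    rewrite -natrM ler_nat -/q; move: n0 ba; clear.
    case: n => // n _ ba; rewrite /q cf_denomSS.
    by apply: leq_trans (leq_addr _ _); rewrite leq_mul2r ba orbT.
  have : 12 * b.-1%:R * Q * cf_gap alpha n <= 1.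
    by apply: le_trans gap; rewrite ler_pM2r// -natrM.
  have -> : 6 * Q * (Delta + b.-1%:R * cf_gap alpha n) =
      2^-1 + 2^-1 * (12 * b.-1%:R * Q * cf_gap alpha n).
    by rewrite /Delta; field; rewrite gt_eqF.
  lra.
have [x [x01 nE nED avoid]] := avoiding_point alpha01 irr n0 D0 W6 (HN _ N0N).
have := trimmed_sum_shift alpha01 irr beta1 n0 x01 b0 kC Cq avoid (hk Nn0).
rewrite -/Nn -/Q -/Delta -/eta; set T := trimmed_sum _ _ _ _ x.
set T' := trimmed_sum _ _ _ _ _ => TT.
have dN := d0 _ Nn0.
have good y : 0 <= y < 1 -> ~ E Nn y ->
    `|trimmed_sum alpha (power_obs beta) (k Nn) Nn y / d Nn - 1| <= eta / 4.
  move=> y01 nEy; rewrite leNgt; apply/negP => lt; apply: nEy; split=> //.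
have xD01 : 0 <= x + Delta < 1.
  have /andP[_] := avoid 0%N Nn0; rewrite /= => xD.
  by case/andP: x01 => x0 _; apply/andP; split; lra.
have := good _ x01 nE; have := good _ xD01 nED; rewrite -/T -/T' !ler_norml.
move=> /andP[h1 _] /andP[_ h2].
have h3 : T' / d Nn <= (1 - eta) * (T / d Nn).
  by rewrite mulrA ler_pM2r ?invr_gt0.
have h4 : (1 - eta) * (T / d Nn) <= (1 - eta) * (1 + eta / 4).
  by rewrite ler_pM2l ?subr_gt0 ?shift_loss_lt1//; lra.
have : 0 < eta * eta by rewrite mulr_gt0.
by lra.
Qed.

End WeakLaw.

Unset Implicit Arguments.
Set Strict Implicit.
Set Printing Implicit Defensive.

Theorem theorem12 (R : realType) (alpha beta : R) (k : nat -> nat)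
    (halpha01 : 0 < alpha < 1) (halpha : irrational alpha)
    (hbeta : 1 < beta)
    (hk : trimming_sequence k) (hmono : monotone_seq k)
    (hko : (fun N : nat => (k N)%:R : R) =o_\oo (fun N : nat => N%:R : R)) :
  let f := power_obs beta in
  let I := exists d : nat -> R,
      positive_seq d /\ trimmed_strong_law_unif alpha f k d in
  let II := exists d : nat -> R,
      positive_seq d /\ trimmed_weak_law alpha f k d in
  let III := trimming_condition alpha k in
  [/\ I <-> II,
      II <-> III &
      III -> forall d : nat -> R, positive_seq d ->
        (forall N : nat, (0 < N)%N -> (1 <= k N)%N ->
           d N = (beta - 1)^-1 * N%:R `^ beta * (k N)%:R `^ (1 - beta)) ->
        trimmed_strong_law_unif alpha f k d /\ trimmed_weak_law alpha f k d].
Proof.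
move=> f I II III.
have ko (eps : R) : 0 < eps ->
    exists N0, forall N, (N0 <= N)%N -> (k N)%:R <= eps * N%:R.
  move=> eps0; have [N0 _ H] := (eqoP _ _ _).1 hko _ eps0; exists N0 => N /H /=.
  by rewrite !ger0_norm.
have strong d : III -> positive_seq d ->
    (forall N : nat, (0 < N)%N -> (1 <= k N)%N ->
       d N = (beta - 1)^-1 * N%:R `^ beta * (k N)%:R `^ (1 - beta)) ->
    trimmed_strong_law_unif alpha f k d.
  exact: trimming_condition_strong_law.
have I_II : I -> II.
  by move=> [d [d0 /trimmed_strong_weak_law H]]; exists d.
have II_III : II -> III.
  by move=> [d [d0 H]]; exact: weak_law_trimming_condition H.
have III_I : III -> I.
  move=> hIII.
  pose d N : R := if (0 < k N)%N
    then (beta - 1)^-1 * N%:R `^ beta * (k N)%:R `^ (1 - beta) else 1.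
  have d0 : positive_seq d.
    move=> N N0; rewrite /d; case: ifP => // k0.
    by rewrite !mulr_gt0 ?invr_gt0 ?subr_gt0 ?powR_gt0 ?ltr0n.
  exists d; split=> //; apply: strong => // N _ k0; by rewrite /d k0.
split; [by split=> // /II_III/III_I | by split=> // /III_I/I_II | ].
by move=> hIII d d0 dE; split; [|apply: trimmed_strong_weak_law]; exact: strong.
Qed.
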